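(* The smallest positive integer $n$ for which the number $E_1(n)$ of sporadic Reinhardt polygons with $n$ sides exceeds the number $E_0(n)$ of periodic Reinhardt polygons with $n$ sides is $n=105$.
   Context: A Reinhardt polygon is an equilateral convex polygon $P$ that may be inscribed in a Reuleaux polygon $R$ in such a way that every vertex of $R$ is a vertex of $P$. The line segments joining vertices of a Reinhardt $n$-gon at maximal distance from one another contain a star polygon whose angles have measures $k_i\pi/n$ with $k_i$ positive integers summing to $n$; listing these in the order of visitation along the star polygon gives a composition $[k_1,\ldots,k_\ell]$ of $n$ into an odd number $\ell$ of parts. Polygons are identified when one is obtained from the other by rotations and flips, so a Reinhardt $n$-gon is identified with the equivalence class of such a composition under the dihedral action (cyclic shifts and reversal of the parts); such a class is called a dihedral composition. Equivalently (Reinhardt's correspondence), a Reinhardt polynomial for $n$ is a polynomial $F(z)$ with $\deg F<n$, all coefficients in $\{-1,0,1\}$, nonzero coefficients alternating in sign, an odd number of nonzero coefficients, and divisible by the cyclotomic polynomial $\Phi_{2n}(z)$. A Reinhardt polynomial $F(z)=\pm\sum_{i=0}^{\ell}(-1)^i z^{k_i}$ with $k_0<k_1<\cdots<k_\ell$ corresponds to the dihedral composition $[k_1-k_0,k_2-k_1,\ldots,k_\ell-k_{\ell-1},n-k_\ell+k_0]$ of $n$. The Reinhardt polygons with $n$ sides (up to equivalence) are exactly the dihedral compositions of $n$ arising in this way. A Reinhardt $n$-gon is periodic if its composition consists of a composition of some divisor $m<n$ of $n$ into an odd number of parts, repeated $n/m$ times. It is sporadic if it is not periodic. $E_0(n)$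 and $E_1(n)$ denote the numbers of periodic and sporadic Reinhardt polygons with $n$ sides, respectively, counted as dihedral equivalence classes. *)

(* Defs.v *)
From mathcomp Require Import all_boot all_order all_algebra all_field.
From mathcomp Require Import boolp.

Set Implicit Arguments.
Unset Strict Implicit.
Unset Printing Implicit Defensive.

Import Order.TTheory GRing.Theory Num.Theory.

Local Open Scope nat_scope.

Definition is_composition (n : nat) (s : seq nat) : bool :=
  (0 \notin s) && (sumn s == n).

(* Equality of compositions read around a circle, up to rotations and flips. *)
Definition dihedral_equiv (T : eqType) (s t : seq T) : bool :=
  [exists k : 'I_(size s).+1, (t == rot k s) || (t == rev (rot k s))].

Definition nonzero_coefs (F : {poly int}) : seq int :=
  [seq c <- F | c != 0%R].

(* [size F <= n] is [deg F < n], and [sorted] compares consecutive entries.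
   Divisibility in {poly int} is pseudo-divisibility, which is ordinary
   divisibility here because 'Phi_(2 * n) is monic. *)
Definition reinhardt_poly (n : nat) (F : {poly int}) : bool :=
  [&& size F <= n,
      all (mem [:: (-1)%R; 0%R; 1%R]) F,
      sorted (fun a b : int => (a * b < 0)%R) (nonzero_coefs F),
      odd (size (nonzero_coefs F))
    & ('Phi_(2 * n) %| F)%R].

Definition exponents (F : {poly int}) : seq nat :=
  [seq k <- iota 0 (size F) | (F`_k != 0)%R].

(* For exponents k_0 < ... < k_l, this is
   [:: k_1 - k_0; ...; k_l - k_(l-1); n - k_l + k_0]. *)
Definition gaps (n : nat) (ks : seq nat) : seq nat :=
  if ks is k0 :: ks' then
    rcons (pairmap (fun a b => b - a) k0 ks') (n - last k0 ks' + k0)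
  else [::].

Definition reinhardt_composition (n : nat) (s : seq nat) : Prop :=
  exists2 F : {poly int}, reinhardt_poly n F & gaps n (exponents F) = s.

Definition periodic_composition (n : nat) (s : seq nat) : Prop :=
  exists m : nat, exists t : seq nat,
    [/\ m %| n, m < n, is_composition m t, odd (size t)
      & s = flatten (nseq (n %/ m) t)].

(* A composition of n has at most n parts, each at most n, so this finite type
   contains all of them (see [parts_surj] below). *)
Notation comp_code n := (n.-bseq 'I_n.+1).

Definition parts (n : nat) (c : comp_code n) : seq nat :=
  [seq nat_of_ord i | i <- c].

Definition dihedral_class (n : nat) (c : comp_code n) : {set comp_code n} :=
  [set d | dihedral_equiv (parts c) (parts d)].

(* A Reinhardt n-gon, up to rotations and flips, is the dihedral class of a
   composition obtained from a Reinhardt polynomial for n. *)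
Definition reinhardt_polygons (n : nat) : {set {set comp_code n}} :=
  [set dihedral_class c | c : comp_code n & `[< reinhardt_composition n (parts c) >]].

Definition periodic (n : nat) (P : {set comp_code n}) : bool :=
  [exists c in P, `[< periodic_composition n (parts c) >]].

Definition sporadic (n : nat) (P : {set comp_code n}) : bool := ~~ periodic P.

Definition E0 (n : nat) : nat := #|[set P in reinhardt_polygons n | periodic P]|.

Definition E1 (n : nat) : nat := #|[set P in reinhardt_polygons n | sporadic P]|.

Lemma parts_surj (n : nat) (s : seq nat) :
  is_composition n s -> exists c : comp_code n, parts c = s.
Proof.
case/andP=> s0 /eqP sn.
have szs : size s <= n.
  rewrite -sn; elim: s s0 {sn} => //= x s IHs.
  rewrite inE negb_or eq_sym -lt0n => /andP[x0 s0].
  by rewrite -add1n leq_add // IHs.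
have sz : size [seq (inord x : 'I_n.+1) | x <- s] <= n by rewrite size_map.
exists (Bseq sz); rewrite /parts /= -map_comp; apply: map_id_in => x xs /=.
rewrite inordK // ltnS -sn; elim: s xs {s0 sn szs sz} => //= y s IHs.
rewrite inE => /predU1P[->|/IHs xs]; first exact: leq_addr.
exact: leq_trans xs (leq_addl _ _).
Qed.

Lemma reinhardt_composition_is_composition (n : nat) (s : seq nat) :
  reinhardt_composition n s -> is_composition n s.
Proof.
case=> F /and5P[szF _ _ oddF _] <-.
have szE : size (exponents F) = size (nonzero_coefs F).
  rewrite /exponents /nonzero_coefs -[in RHS](mkseq_nth 0%R F) /mkseq filter_map.
  by rewrite size_map.
have le_n : all (fun k => k < n) (exponents F).
  apply/allP=> k; rewrite mem_filter mem_iota add0n => /and3P[_ _ kF].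
  exact: leq_trans kF szF.
have srt : sorted ltn (exponents F).
  by apply: sorted_filter; [exact: ltn_trans | exact: iota_ltn_sorted].
move: oddF; rewrite -szE.
case: (exponents F) le_n srt => //= k0 ks /andP[k0n ksn] pth _.
rewrite /is_composition /gaps mem_rcons inE sumn_rcons.
have last_n : last k0 ks < n.
  by have := mem_last k0 ks; rewrite inE => /predU1P[->//|/(allP ksn)].
rewrite negb_or eq_sym addn_eq0 subn_eq0 negb_and -ltnNge last_n orTb andTb.
suff [-> /eqP] : 0 \notin pairmap (fun a b => b - a) k0 ks /\
    sumn (pairmap (fun a b => b - a) k0 ks) + k0 = last k0 ks.
  by move=> E; rewrite andTb addnC -addnA (addnC k0) (eqP E) subnK // ltnW.
elim: ks k0 pth {k0n ksn last_n szE szF} => [|k ks IHks] k0 //=.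
case/andP=> lt_k /IHks[n0 <-]; rewrite inE negb_or n0 eq_sym subn_eq0 -ltnNge lt_k.
by split=> //; rewrite addnAC subnK ?(ltnW lt_k) // addnC.
Qed.

(* Main.v *)
Require Import Defs.
From mathcomp Require Import all_boot all_order all_algebra all_field.
From mathcomp Require Import boolp.
From mathcomp Require Import zify ring.

(** A Reinhardt polynomial [F] is, up to sign and a power of [z], the sum
    [1 - z^(k_1) + z^(k_1 + k_2) - ...] of an odd number of terms.  Writing
    the composition [k_1, k_2, ...] as the run lengths of a word of signs, with
    generating polynomial [W] of degree less than [n], gives
    [(1 - z) W = +- (2 F - 1 - z^n)] when [F] starts at exponent 0.  At a
    primitive [2n]-th root of unity the last two terms cancel, so that
    ['Phi_(2n)] divides [F] if and only if it divides [W]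
    ([reinhardt_compositionP]).  The alternation of the signs in [F] thus becomes
    automatic: every word extends to a sequence with [b(k + n) = - b(k)], and
    polygons are the orbits, under shifts and reversal, of the words on which
    ['Phi_(2n)] vanishes ([dihedral_equivP], [reinhardt_polygonsE]).  A polygon is
    periodic when its words already satisfy [b(k + m) = - b(k)] for a proper
    divisor [m] of [n] ([periodic_compositionP]).

    Vanishing is a linear condition: a word vanishes if and only if the product of
    the operators [1 + S^(n/p)], for the odd primes [p] dividing [n] and the shift
    [S], kills it ([shift_sums_vanishing], [vanishing_shift_sums]), since the
    [n]-th roots of [-1] that are not primitive [2n]-th roots of unity are exactly
    the roots of the polynomials [z^(n/p) + 1].

    With at most one odd prime, every vanishing word is periodic.  Let
    [n = p q r], with [p < q] the odd primes dividing [n].  The condition says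
    that on each of the [r] cosets of the multiples of [r] the signs, after a
    twist, form a [p x q] matrix that is the sum of a function of the row and a
    function of the column.  As the entries are signs, the matrix depends on the
    row only or on the column only, whence at most [(2^p + 2^q - 2)^r] vanishing
    words, of which at least [2^(p r) + 2^(q r) - 2^r] are periodic
    ([card_sporadic_words]).  A sporadic word has [2n] distinct shifts, so its
    orbit has [4n] elements unless it has a reflection symmetry
    ([geq_card_classes]), while a word of antiperiod [q r] has at most [4 q r]
    images; this gives an upper bound for [E1 n] and a lower bound for [E0 n].
    Counting every orbit as if it were symmetric is enough for all [n < 105]
    except [n = 90], where symmetric words have to be counted as well
    ([card_reflected]).

    For [n = 105] the inequalities go the other way.  By the Chinese remainder
    theorem a word is a function on [3 x 5 x 7] cells, and it vanishes when its 7
    slices, of size [3 x 5], have the same second differences.  Collecting 31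
    possible tables of second differences, one with 38 slices and 30 with 20
    slices, gives [38^7 + 30 * 20^7] vanishing words ([card_vanishing_105_ge]);
    about [2^35] of them are periodic, and an orbit has at most 420 elements.
    Hence [E1 105] is at least [2.8 * 10^8], whereas almost all periodic words
    have antiperiod 35 and an orbit of 140 elements, so that [E0 105] is at most
    [2.5 * 10^8] ([E0_105_upper]). *)

Set Implicit Arguments.
Unset Strict Implicit.
Unset Printing Implicit Defensive.

Import Order.TTheory GRing.Theory Num.Theory.

Local Open Scope nat_scope.

(** * Words and their antiperiodic extension *)

(** A word of length [n] encodes the sign sequence [b] with [b(k + n) = - b(k)]
    whose first [n] signs it lists; [ext] is that sequence, as Booleans. *)
Definition ext (n : nat) (b : n.-tuple bool) (k : nat) : bool :=
  nth false b (k %% n) (+) odd (k %/ n).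

Definition word_of (n : nat) (f : nat -> bool) : n.-tuple bool :=
  [tuple f i | i < n].

Lemma mul_pred_sq k N : 1 < N -> k * (N.-1 * N.-1) = k * N.-2 * N + k.
Proof. by case: N => [|[|N]] //= _; nia. Qed.

Section Words.
Variable n : nat.
Hypothesis n_gt0 : 0 < n.
Implicit Types (b x y : n.-tuple bool) (f : nat -> bool) (i j k m : nat).

Lemma ext_small b k : k < n -> ext b k = nth false b k.
Proof. by move=> lt_kn; rewrite /ext modn_small // divn_small // addbF. Qed.

Lemma ext_addn b k : ext b (k + n) = ~~ ext b k.
Proof.
by rewrite /ext modnDr divnDr ?dvdnn // divnn n_gt0 oddD addbA addbT.
Qed.

Lemma ext_addMn b k m : ext b (k + m * n) = ext b k (+) odd m.
Proof.
elim: m => [|m IHm]; first by rewrite addn0 addbF.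
by rewrite mulSn addnCA addnC ext_addn IHm /= addbN.
Qed.

Lemma ext_period b k m : ext b (k + m * (2 * n)) = ext b k.
Proof. by rewrite mulnA ext_addMn oddM andbF addbF. Qed.

Lemma ext_inj b b' : ext b =1 ext b' -> b = b'.
Proof.
move=> eq_bb.
apply: val_inj; apply: (@eq_from_nth _ false) => [|i]; first by rewrite !size_tuple.
by rewrite size_tuple => lt_in; rewrite -!ext_small // eq_bb.
Qed.

Lemma nth_word_of f k : k < n -> nth false (word_of n f) k = f k.
Proof. by move=> lt_kn; rewrite (nth_mktuple _ _ (Ordinal lt_kn)). Qed.

Lemma ext_word_of f : (forall k, f (k + n) = ~~ f k) -> ext (word_of n f) =1 f.
Proof.
move=> fN k; have f_addMn i m : f (i + m * n) = f i (+) odd m.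
  elim: m => [|m IHm]; first by rewrite addn0 addbF.
  by rewrite mulSn addnCA addnC fN IHm /= addbN.
by rewrite [in RHS](divn_eq k n) addnC f_addMn /ext nth_word_of ?ltn_pmod.
Qed.

Definition shift j b := word_of n (fun k => ext b (k + j)).

(** Modulo the period [2 * n], the index [n.-1 + k * (2 * n).-1] is
    [n - 1 - k]; this form avoids truncated subtraction. *)
Definition flip b := word_of n (fun k => ext b (n.-1 + k * (2 * n).-1)).

Lemma ext_shift j b k : ext (shift j b) k = ext b (k + j).
Proof. by rewrite ext_word_of // => i; rewrite addnAC ext_addn. Qed.

Lemma ext_flip b k : ext (flip b) k = ext b (n.-1 + k * (2 * n).-1).
Proof.
rewrite ext_word_of // => i; rewrite mulnDl addnA (mulnC n) ext_addMn.
have -> : (2 * n).-1 = (n.-1).*2.+1 by lia.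
by rewrite /= odd_double addbT.
Qed.

Lemma ext_eq_mod b i j : i = j %[mod 2 * n] -> ext b i = ext b j.
Proof.
move=> eq_ij; rewrite (divn_eq i (2 * n)) (divn_eq j (2 * n)) eq_ij.
by rewrite ![_ * (2 * n) + _]addnC !ext_period.
Qed.

Lemma ext_flip_sub b k m : m + k = n.-1 %[mod 2 * n] -> ext (flip b) k = ext b m.
Proof.
move=> eq_mk; rewrite ext_flip; apply: ext_eq_mod.
rewrite -modnDml -eq_mk modnDml -addnA -mulnS prednK ?muln_gt0 //.
by rewrite addnC modnMDl.
Qed.

Lemma shift0 b : shift 0 b = b.
Proof. by apply: ext_inj => k; rewrite ext_shift addn0. Qed.

Lemma shift_add i j b : shift i (shift j b) = shift (i + j) b.
Proof. by apply: ext_inj => k; rewrite !ext_shift addnA. Qed.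

Lemma shift_eq_mod i j b : i = j %[mod 2 * n] -> shift i b = shift j b.
Proof.
move=> eq_ij; apply: ext_inj => k; rewrite !ext_shift; apply: ext_eq_mod.
by rewrite -modnDmr eq_ij modnDmr.
Qed.

Lemma flip_flip b : flip (flip b) = b.
Proof.
apply: ext_inj => k; rewrite !ext_flip; apply: ext_eq_mod.
rewrite mulnDl -mulnA addnA -mulnS prednK ?muln_gt0 // modnMDl.
rewrite mul_pred_sq ?(@leq_pmulr 2 n) //.
by rewrite modnMDl.
Qed.

Lemma flip_shift j b : flip (shift j b) = shift (j * (2 * n).-1) (flip b).
Proof.
apply: ext_inj => k; rewrite ext_flip !ext_shift ext_flip; apply: ext_eq_mod.
rewrite mulnDl addnA -mulnA.
rewrite mul_pred_sq ?(@leq_pmulr 2 n) //.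
by rewrite [in RHS]addnCA modnMDl.
Qed.

(** As [shift n] negates a word, these are the [4 * n] elements of a dihedral
    group acting on antiperiodic sequences. *)
Definition act j (e : bool) b := shift j (if e then flip b else b).

Definition orb b := [set act u.1 u.2 b | u : 'I_(2 * n) * bool].

Lemma orbP b x : reflect (exists j e, x = act j e b) (x \in orb b).
Proof.
apply: (iffP imsetP) => [[[j e] _ ->]|[j [e ->]]]; first by exists j, e.
have lt_j : j %% (2 * n) < 2 * n by rewrite ltn_pmod ?muln_gt0.
by exists (Ordinal lt_j, e) => //; apply: shift_eq_mod; rewrite /= modn_mod.
Qed.

Lemma orb_refl b : b \in orb b.
Proof. by apply/orbP; exists 0, false; rewrite /act shift0. Qed.

Lemma orb_shift j b : shift j b \in orb b.
Proof. by apply/orbP; exists j, false. Qed.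

Lemma orb_flip b : flip b \in orb b.
Proof. by apply/orbP; exists 0, true; rewrite /act shift0. Qed.

Lemma orb_trans b x y : x \in orb b -> y \in orb x -> y \in orb b.
Proof.
move=> /orbP[j [e ->]] /orbP[i [d ->]]; apply/orbP; rewrite /act.
case: d; last by exists (i + j), e; rewrite shift_add.
rewrite flip_shift shift_add; exists (i + j * (2 * n).-1), (~~ e).
by case: e => //=; rewrite flip_flip.
Qed.

Lemma orb_sym b x : x \in orb b -> b \in orb x.
Proof.
move=> /orbP[j [e ->]]; apply: (@orb_trans _ (if e then flip b else b)).
  apply/orbP; exists (j * (2 * n).-1), false; rewrite /act shift_add addnC -mulnS.
  rewrite prednK ?muln_gt0 // (@shift_eq_mod _ 0) ?shift0 //.
  by rewrite modnMl mod0n.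
case: e; last exact: orb_refl.
by rewrite -{1}(flip_flip b) orb_flip.
Qed.

Lemma orb_eq b x : x \in orb b -> orb x = orb b.
Proof.
move=> xb; apply/setP=> y; apply/idP/idP; first exact: orb_trans.
by apply: orb_trans; apply: orb_sym.
Qed.

End Words.

(** * Words of compositions *)

(** Run lengths turn the alternation of the signs of a Reinhardt polynomial into
    a word without any constraint on its signs. *)
Fixpoint runs (b : bool) (s : seq nat) : seq bool :=
  if s is k :: s' then nseq k b ++ runs (~~ b) s' else [::].

Lemma size_runs b s : size (runs b s) = sumn s.
Proof. by elim: s b => //= k s IHs b; rewrite size_cat size_nseq IHs. Qed.

Lemma runs_cat b s t : runs b (s ++ t) = runs b s ++ runs (b (+) odd (size s)) t.
Proof.
elim: s b => [|k s IHs] b /=; first by rewrite addbF.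
by rewrite IHs catA addNb addbN.
Qed.

Lemma runs_negb b s : runs (~~ b) s = [seq ~~ c | c <- runs b s].
Proof. by elim: s b => //= k s IHs b; rewrite map_cat map_nseq IHs. Qed.

Lemma rev_runs b s : rev (runs b s) = runs (b (+) ~~ odd (size s)) (rev s).
Proof.
elim: s b => [|k s IHs] b //=.
rewrite rev_cat IHs rev_cons -cats1 runs_cat /= cats0 rev_nseq size_rev.
by congr (_ ++ nseq _ _); [congr runs|]; case: b; case: odd.
Qed.

(** The first part is recovered as the place of the first change of sign. *)
Lemma find_runs b k s :
  0 \notin s -> find (fun c => c != b) (runs b (k :: s)) = k.
Proof.
move=> s0; rewrite /= find_cat has_nseq eqxx andbF size_nseq.
suff -> : find (fun c => c != b) (runs (~~ b) s) = 0 by rewrite addn0.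
case: s s0 => //= m s; rewrite inE negb_or => /andP[m0 _].
by case: m m0 => //= m _; case: b.
Qed.

Lemma runs_inj b s t : 0 \notin s -> 0 \notin t -> runs b s = runs b t -> s = t.
Proof.
elim: s t b => [|k s IHs] [|m t] b //.
- by case: m.
- by case: k.
rewrite !inE !negb_or => /andP[k0 s0] /andP[m0 t0] eq_st.
have := congr1 (find (fun c => c != b)) eq_st; rewrite !find_runs // => eq_km.
move/eqP: eq_st; rewrite /= eq_km eqseq_cat // => /andP[_ /eqP].
by move/(IHs _ _ s0 t0) ->.
Qed.

(** Induction on the word: a new letter extends the first run or starts one. *)
Lemma runs_surj w : exists2 s, 0 \notin s & runs (head true w) s = w.
Proof.
elim: w => [|c [|d w] [s s0 Es]]; first by exists [::].
  by exists [:: 1].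
have [eq_cd|neq_cd] := eqVneq c d; last first.
  by exists (1 :: s) => //=; rewrite -Es; case: c d neq_cd {Es} => [] [].
case: s s0 Es => [|k s] //=; rewrite inE negb_or eq_cd => /andP[_ s0] Es.
by exists (k.+1 :: s) => //=; rewrite Es.
Qed.

Lemma head_runs b s : 0 \notin s -> head b (runs b s) = b.
Proof. by case: s => [|[|k] s]. Qed.

Lemma last_runs b s : 0 \notin s -> last (~~ b) (runs b s) = b (+) ~~ odd (size s).
Proof.
elim: s b => [|k s IHs] b /=; first by rewrite addbT.
rewrite inE negb_or => /andP[k0 s0]; rewrite last_cat.
case: k k0 => // k _; have -> : last (~~ b) (nseq k.+1 b) = ~~ ~~ b.
  by rewrite negbK /=; elim: k.
by rewrite IHs // addNb -addbN.
Qed.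

Definition comp_word n s : n.-tuple bool := word_of n (nth false (runs true s)).

Definition odd_composition n s : bool := is_composition n s && odd (size s).

Section CompositionWords.
Variable n : nat.
Hypothesis n_gt0 : 0 < n.
Implicit Types (b x y : n.-tuple bool) (s t : seq nat) (j k e : nat).

Lemma comp_wordE s : odd_composition n s -> comp_word n s = runs true s :> seq bool.
Proof.
case/andP=> /andP[_ /eqP sum_s] _; apply: (@eq_from_nth _ false).
  by rewrite size_tuple size_runs sum_s.
by move=> i; rewrite size_tuple => lt_in; rewrite nth_word_of.
Qed.

Lemma comp_word_inj s t : odd_composition n s -> odd_composition n t ->
  comp_word n s = comp_word n t -> s = t.
Proof.
move=> vs vt /(congr1 val) /=; rewrite !comp_wordE //.
by case/andP: vs => /andP[s0 _] _; case/andP: vt => /andP[t0 _] _; apply: runs_inj.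
Qed.

(** An odd number of runs starting with [true] ends with [true]: in the
    antiperiodic sequence, position 0 is then preceded by [false], that is, a run
    starts there.  These words are exactly the words of compositions. *)
Definition cut b := ext b 0 && ext b n.-1.

Lemma cutE b : cut b = (head true b && last false b).
Proof.
have sz := size_tuple b; rewrite /cut !ext_small ?prednK // nth0.
rewrite -[in n.-1]sz nth_last.
by case: (tval b) sz => // sz0; move: n_gt0; rewrite -sz0.
Qed.

Lemma cut_comp_word s : odd_composition n s -> cut (comp_word n s).
Proof.
move=> vs; rewrite cutE comp_wordE //; case/andP: vs => /andP[s0 _] odd_s.
by rewrite head_runs // (@last_runs true) // odd_s.
Qed.

Lemma cut_surj b : cut b -> exists2 s, odd_composition n s & comp_word n s = b.
Proof.
rewrite cutE => /andP[hb lb]; have [s s0 Es] := runs_surj b; rewrite hb in Es.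
have vs : odd_composition n s.
  rewrite /odd_composition /is_composition s0 -(size_runs true) Es size_tuple eqxx.
  by move: lb; rewrite -Es (@last_runs true) //=; case: odd.
by exists s => //; apply: val_inj; rewrite /= comp_wordE.
Qed.

(** The signs at 0 and at [n] differ, so a run of [true] starts somewhere. *)
Lemma exists_cut b : exists j, cut (shift j b).
Proof.
wlog b0 : b / ext b 0 = false => [W|].
  case b0: (ext b 0); last exact: W.
  have [|j cj] := W (shift n b); first by rewrite ext_shift // ext_addn // b0.
  by exists (j + n); rewrite -shift_add.
have ex_j : exists j, ext b j by exists n; have := ext_addn n_gt0 b 0; rewrite add0n b0.
case: (ex_minnP ex_j) => -[|j]; first by rewrite b0.
move=> bj min_j; exists j.+1; rewrite /cut !ext_shift // add0n bj.
have -> : n.-1 + j.+1 = j + n by lia.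
by rewrite ext_addn //; apply: contraTN (ltnSn j) => /min_j; rewrite leqNgt.
Qed.

Lemma odd_composition_rot k s : odd_composition n s -> odd_composition n (rot k s).
Proof.
rewrite /odd_composition /is_composition mem_rot size_rot.
by rewrite /rot sumn_cat addnC -sumn_cat cat_take_drop.
Qed.

Lemma odd_composition_rev s : odd_composition n s -> odd_composition n (rev s).
Proof. by rewrite /odd_composition /is_composition mem_rev size_rev sumn_rev. Qed.

Lemma ext_inj_small b x : (forall i, i < n -> ext b i = ext x i) -> b = x.
Proof.
move=> eq_bx; apply: val_inj; apply: (@eq_from_nth _ false); first by rewrite !size_tuple.
by move=> i; rewrite size_tuple => lt_in; rewrite -!ext_small ?eq_bx.
Qed.

(** Dropping the first run leaves a word that starts with [false]; the extra shift
    by [n] restores the sign. *)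
Lemma comp_word_rot1 k s : odd_composition n (k :: s) ->
  comp_word n (rcons s k) = shift (n + k) (comp_word n (k :: s)).
Proof.
move=> vs; have := odd_composition_rot 1 vs; rewrite rot1_cons => vs1.
have /andP[/andP[_ /eqP/= sum_s] /= odd_s] := vs.
apply: ext_inj_small => i lt_in; rewrite ext_shift // addnA addnAC ext_addn //.
have w_nth m : m < n -> ext (comp_word n (k :: s)) m =
    nth false (nseq k true ++ runs false s) m.
  by move=> lt_m; rewrite ext_small // comp_wordE.
rewrite ext_small // comp_wordE // -cats1 runs_cat /= (negbTE odd_s) cats0.
rewrite -[in runs true s](negbK true) runs_negb nth_cat size_map size_runs.
case: (ltnP (i + k) n) => [lt_ik|le_nik].
  have lt_i : i < sumn s by lia.
  rewrite lt_i (nth_map false) ?size_runs // w_nth // nth_cat size_nseq.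
  by rewrite ltnNge leq_addl addnK.
have -> : (i < sumn s) = false by lia.
rewrite -(subnK le_nik) ext_addn // w_nth; last by lia.
rewrite nth_cat size_nseq !nth_nseq negbK.
have -> : i - sumn s < k by lia.
by have -> : i + k - n < k by lia.
Qed.

(** The number of runs is odd, so the reversed word starts with [true] too. *)
Lemma comp_word_rev s : odd_composition n s ->
  comp_word n (rev s) = flip (comp_word n s).
Proof.
move=> vs; apply: ext_inj_small => i lt_in.
have /andP[/andP[_ /eqP sum_s] odd_s] := vs.
rewrite (@ext_flip_sub _ n_gt0 _ _ (n - i.+1)) //; last by congr (_ %% _); lia.
rewrite !ext_small ?comp_wordE ?odd_composition_rev //; last by lia.
by have := rev_runs true s; rewrite odd_s => <-; rewrite nth_rev size_runs sum_s.
Qed.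

Lemma comp_word_rot k s : odd_composition n s ->
  exists j, comp_word n (rot k s) = shift j (comp_word n s).
Proof.
move=> vs; case: (leqP k (size s)) => [|/ltnW/rot_oversize->]; last first.
  by exists 0; rewrite shift0.
elim: k => [|k IHk] lt_ks; first by exists 0; rewrite rot0 shift0.
have [j Ej] := IHk (ltnW lt_ks); rewrite -add1n rotD //.
have := odd_composition_rot k vs; move: Ej; case: (rot k s) => [_ /andP[_]|m t] //.
move=> Et /comp_word_rot1; rewrite rot1_cons => ->.
by exists (n + m + j); rewrite Et shift_add.
Qed.

(** A shift of the word of [s] is again the word of a composition only if it
    starts at the beginning of a run.  The multiple [e * n] records the sign
    changes when runs are removed one by one. *)
Lemma shift_comp_word_rot j e s t :
    odd_composition n s -> odd_composition n t ->
  comp_word n t = shift (j + e * n) (comp_word n s) ->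
  exists2 k, k <= size s & t = rot k s.
Proof.
elim/ltn_ind: j e s => j IHj e s vs vt Et.
have /andP[t0 tn] := cut_comp_word vt; have /andP[s0 sn] := cut_comp_word vs.
move: t0; rewrite {1}Et ext_shift // add0n ext_addMn // => t0.
have [j0|j_gt0] := posnP j.
  exists 0; rewrite // rot0; apply: comp_word_inj => //.
  move: t0; rewrite j0 s0 => e0; apply: ext_inj => // i.
  by rewrite Et ext_shift // j0 add0n ext_addMn // (negbTE e0) addbF.
case: s s0 vs sn Et t0 => [_ /andP[_]|k s s0 vs sn Et t0] //.
have k_le : k <= n by case/andP: vs => /andP[_ /eqP <-] _; apply: leq_addr.
have [lt_jk|le_kj] := ltnP j k.
  have first_block m : m < k -> ext (comp_word n (k :: s)) m.
    move=> lt_mk; rewrite ext_small ?(leq_trans lt_mk) // comp_wordE //=.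
    by rewrite nth_cat size_nseq lt_mk nth_nseq lt_mk.
  move: tn; rewrite Et ext_shift //.
  have -> : n.-1 + (j + e * n) = j.-1 + (e.+1) * n by nia.
  rewrite ext_addMn // first_block; last by lia.
  by move: t0; rewrite first_block //= => /negbTE->.
have j1 : j - k < j.
  by rewrite ltn_subrL j_gt0 andbT; case/andP: vs => /andP[]; case: (k).
have vs1 := odd_composition_rot 1 vs; rewrite rot1_cons in vs1.
have [] := IHj (j - k) j1 e.+1 _ vs1 vt.
  rewrite comp_word_rot1 // shift_add // Et; apply: shift_eq_mod => //.
  have -> : j - k + e.+1 * n + (n + k) = 1 * (2 * n) + (j + e * n) by nia.
  by rewrite modnMDl.
move=> i; rewrite size_rcons leq_eqVlt => /predU1P[->|lt_i] ->.
  by exists 1; rewrite // -(size_rcons s k) rot_size rot1_cons.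
by exists (i + 1); [rewrite addn1 | rewrite rotD ?rot1_cons // addn1].
Qed.

Lemma dihedral_equivP s t : odd_composition n s ->
  dihedral_equiv s t =
    odd_composition n t && (comp_word n t \in orb (comp_word n s)).
Proof.
move=> vs; apply/existsP/andP => [[k]|[vt /orbP[] // j [e]]].
  have [j Ej] := comp_word_rot k vs; have vk := odd_composition_rot k vs.
  case/orP=> /eqP ->.
    by rewrite vk Ej orb_shift.
  rewrite odd_composition_rev // comp_word_rev // Ej; split=> //.
  by apply: orb_trans (orb_flip _ _) => //; apply: orb_shift.
have ordk k : k <= size s -> k < (size s).+1 by [].
rewrite /act -[j]addn0 -(mul0n n); case: e; last first.
  by case/(shift_comp_word_rot vs vt) => k /ordk lek ->; exists (Ordinal lek); rewrite eqxx.
rewrite -comp_word_rev // => /(shift_comp_word_rot (odd_composition_rev vs) vt).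
case=> k; rewrite size_rev => le_k ->.
exists (Ordinal (ordk _ (leq_subr k (size s)))); apply/orP; right; apply/eqP.
by rewrite rev_rot /= /rotr size_rev subKn.
Qed.

End CompositionWords.

(** * Cyclotomic divisibility *)

Local Notation pZtoC := (map_poly (intr : int -> algC)).

(** The remainder of [P] modulo ['Phi_N] has smaller degree than the minimal
    polynomial of [z] over the rationals, which is ['Phi_N]. *)
Lemma Cyclotomic_dvdP N (z : algC) (P : {poly int}) : N.-primitive_root%R z ->
  ('Phi_N %| P)%R = root (pZtoC P) z.
Proof.
move=> prim_z; have mon := Cyclotomic_monic N.
have Phiz : (pZtoC 'Phi_N).[z]%R = 0%R.
  by apply/rootP; rewrite (Cintr_Cyclotomic prim_z) root_cyclotomic.
have E := Pdiv.IdomainMonic.divp_eq mon P.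
have -> : root (pZtoC P) z = root (pZtoC (P %% 'Phi_N)%R) z.
  by rewrite {1}E rmorphD rmorphM /= !rootE hornerD hornerM Phiz mulr0 add0r.
rewrite /dvdp; set R := (_ %% _)%R; have sizeR : size R < size 'Phi_N.
  by rewrite ltn_modp monic_neq0.
apply/eqP/idP => [->|R0]; first by rewrite rmorph0 root0.
have [q [Dq _] dv_q] := minCpolyP z.
have R_rat : pZtoC R = map_poly ratr (map_poly (intr : int -> rat) R).
  by rewrite -map_poly_comp; apply: eq_map_poly => c /=; rewrite ratr_int.
move: R0; rewrite R_rat dv_q => dvR.
have map0 : map_poly (intr : int -> rat) R = 0%R.
  apply/eqP; apply: contraTT sizeR => /dvdp_leq/(_ dvR).
  rewrite -(size_map_poly (@ratr algC)) -Dq (minCpoly_cyclotomic prim_z).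
  rewrite -(Cintr_Cyclotomic prim_z) !(size_map_inj_poly (@intr_inj _)) //.
  by rewrite -leqNgt.
apply/polyP=> i; apply: (@intr_inj rat).
by rewrite -(coef_map (intr : {rmorphism int -> rat})) map0 !coef0.
Qed.

(** Horner form of [1 - z^k_1 + z^(k_1 + k_2) - ...], which is the Reinhardt
    polynomial of the composition [s] up to sign and a power of [z]. *)
Fixpoint alt_sum (z : algC) (s : seq nat) : algC :=
  if s is k :: s' then (1 - z ^+ k * alt_sum z s')%R else 0%R.

Definition word_sum (z : algC) (w : seq bool) : algC :=
  (\sum_(i < size w) (-1) ^+ nth false w i * z ^+ i)%R.

Lemma word_sum_cat z v w :
  (word_sum z (v ++ w) = word_sum z v + z ^+ size v * word_sum z w)%R.
Proof.
rewrite /word_sum size_cat big_split_ord /= mulr_sumr; congr (_ + _)%R.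
  by apply: eq_bigr => i _; rewrite nth_cat ltn_ord.
apply: eq_bigr => i _; rewrite nth_cat ltnNge leq_addr addKn exprD; ring.
Qed.

(** Multiplication by [1 - z] telescopes inside each run, and only the ends of
    runs survive, each counted twice except for the two ends of the word. *)
Lemma runs_word_sum z b s :
  ((1 - z) * word_sum z (runs b s) =
   (-1) ^+ b * (2 * alt_sum z s - 1 + (-1) ^+ size s * z ^+ sumn s))%R.
Proof.
elim: s b => [|k s IHs] b /=.
  by rewrite /word_sum big_ord0; ring.
rewrite word_sum_cat size_nseq mulrDr mulrCA IHs.
have -> : word_sum z (nseq k b) = ((-1) ^+ b * \sum_(i < k) z ^+ i)%R.
  rewrite /word_sum size_nseq mulr_sumr.
  by apply: eq_bigr => i _; rewrite nth_nseq ltn_ord.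
have geom : ((1 - z) * \sum_(i < k) z ^+ i = 1 - z ^+ k)%R.
  by rewrite -opprB mulNr -subrX1 opprB.
rewrite mulrCA geom.
by rewrite exprD exprS; case: b => /=; ring.
Qed.

Definition sign_poly n (b : n.-tuple bool) : {poly int} :=
  (\poly_(k < n) (-1) ^+ nth false b k)%R.

Definition vanishing n (b : n.-tuple bool) : bool :=
  ('Phi_(2 * n) %| sign_poly b)%R.

Lemma prim_expn n (z : algC) : 0 < n -> (2 * n).-primitive_root%R z -> (z ^+ n = -1)%R.
Proof.
move=> n_gt0 prim_z; have := prim_expr_order prim_z; rewrite mulnC exprM.
move/eqP; rewrite sqrf_eq1 => /orP[|/eqP//].
by rewrite -(prim_order_dvd prim_z) => /dvdn_leq; lia.
Qed.

Lemma vanishingE n (b : n.-tuple bool) (z : algC) : 0 < n ->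
  (2 * n).-primitive_root%R z -> vanishing b = (word_sum z b == 0%R).
Proof.
move=> n_gt0 prim_z; rewrite /vanishing (Cyclotomic_dvdP _ prim_z) rootE.
congr (_ == _); rewrite /sign_poly /word_sum size_tuple.
rewrite (@horner_coef_wide _ n); last first.
  by apply: leq_trans (size_poly _ _) (size_poly _ _).
apply: eq_bigr => i _; rewrite coef_map coef_poly ltn_ord /=.
by rewrite rmorphXn rmorphN1.
Qed.

Lemma prim_neq1 n (z : algC) : 0 < n -> (2 * n).-primitive_root%R z -> z != 1%R.
Proof.
move=> n_gt0 prim_z; apply/negP => /eqP z1; have := prim_expn n_gt0 prim_z.
by rewrite z1 expr1n => /eqP; rewrite -addr_eq0 (pnatr_eq0 _ 2).
Qed.

(** The contributions of the two ends of the word are [-1] and [- z^n = 1]. *)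
Lemma vanishing_alt_sum n s (z : algC) : 0 < n -> odd_composition n s ->
  (2 * n).-primitive_root%R z -> vanishing (comp_word n s) = (alt_sum z s == 0%R).
Proof.
move=> n_gt0 vs prim_z; rewrite (vanishingE _ n_gt0 prim_z) comp_wordE //.
have := runs_word_sum z true s.
case/andP: vs => /andP[_ /eqP ->] odd_s.
rewrite -(signr_odd _ (size s)) odd_s (prim_expn n_gt0 prim_z) expr1 mulrN1 opprK subrK mulN1r.
move=> E; have := congr1 (fun x => x == 0%R) E.
rewrite mulf_eq0 subr_eq0 eq_sym (negbTE (prim_neq1 n_gt0 prim_z)) /=.
by rewrite oppr_eq0 mulf_eq0 (pnatr_eq0 _ 2).
Qed.

(** * Reinhardt polynomials and words *)

Lemma horner_exponents (F : {poly int}) (z : algC) :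
  ((pZtoC F).[z] = \sum_(k <- exponents F) (F`_k)%:~R * z ^+ k)%R.
Proof.
rewrite horner_coef (size_map_inj_poly (@intr_inj _)) // big_filter.
rewrite -(big_mkord xpredT (fun i => (pZtoC F)`_i * z ^+ i)%R) /index_iota subn0.
rewrite [RHS]big_mkcond; apply: eq_bigr => i _; rewrite coef_map /=.
by case: eqP => //= ->; rewrite mul0r.
Qed.

Lemma nonzero_coefsE (F : {poly int}) :
  nonzero_coefs F = [seq (F`_k)%R | k <- exponents F].
Proof.
rewrite /exponents /nonzero_coefs -[in LHS](mkseq_nth 0%R F) /mkseq filter_map.
by congr map; apply: eq_filter.
Qed.

Lemma mem_exponents (F : {poly int}) k : (k \in exponents F) = (F`_k != 0)%R.
Proof.
rewrite mem_filter mem_iota add0n; apply: andb_idr => Fk.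
by rewrite ltnNge; apply: contraNN Fk => le_k; rewrite nth_default.
Qed.

Lemma sorted_exponents (F : {poly int}) : sorted ltn (exponents F).
Proof. by apply: sorted_filter; [exact: ltn_trans | exact: iota_ltn_sorted]. Qed.

(** Nonzero coefficients 1 and -1 of alternating signs are determined by the first
    one. *)
Lemma alternating_sum_gaps (F : {poly int}) (z : algC) (m k0 : nat) ks :
  path ltn k0 ks ->
  {subset k0 :: ks <= exponents F} ->
  all (mem [:: (-1)%R; 0%R; 1%R]) F ->
  path (fun a b : int => (a * b < 0)%R) (F`_k0)%R [seq (F`_k)%R | k <- ks] ->
  (\sum_(k <- k0 :: ks) (F`_k)%:~R * z ^+ k =
   (F`_k0)%:~R * (z ^+ k0 * alt_sum z (rcons (pairmap (fun a b => b - a)%N k0 ks) m)))%R.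
Proof.
move=> + + small_F; have unit_F k : k \in exponents F -> (F`_k = 1 \/ F`_k = -1)%R.
  rewrite mem_filter mem_iota add0n => /and3P[Fk _ lt_k].
  have /(allP small_F) : (F`_k)%R \in (F : seq int) by rewrite mem_nth.
  rewrite !inE (negbTE Fk) /= => /orP[]/eqP->; by [right|left].
elim: ks k0 => [|k1 ks IHks] k0 /=.
  by move=> _ _ _; rewrite big_seq1 mulr0 subr0 mulr1.
case/andP=> lt_k01 path_ks sub_ks /andP[alt_01 alt_ks].
rewrite big_cons IHks => //; last first.
  by move=> k k_ks; apply: sub_ks; rewrite inE k_ks orbT.
have -> : (F`_k1 = - F`_k0)%R.
  move: alt_01; have [|->|->] := unit_F k0; first by apply: sub_ks; rewrite mem_head.
    by have [|->|->] := unit_F k1; first by apply: sub_ks; rewrite inE mem_head orbT.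
  by have [|->|->] := unit_F k1; first by apply: sub_ks; rewrite inE mem_head orbT.
have -> : (z ^+ k1 = z ^+ k0 * z ^+ (k1 - k0))%R by rewrite -exprD subnKC // ltnW.
by rewrite rmorphN /=; ring.
Qed.

Lemma size_gaps n ks : size (gaps n ks) = size ks.
Proof. by case: ks => // k ks; rewrite /= size_rcons size_pairmap. Qed.

Lemma root_alt_sum_gaps n (F : {poly int}) (z : algC) : z != 0%R ->
  all (mem [:: (-1)%R; 0%R; 1%R]) F ->
  sorted (fun a b : int => (a * b < 0)%R) (nonzero_coefs F) ->
  root (pZtoC F) z = (alt_sum z (gaps n (exponents F)) == 0%R).
Proof.
move=> z0 small_F; rewrite rootE horner_exponents nonzero_coefsE.
have := sorted_exponents F; have : {subset exponents F <= exponents F} by [].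
case: {1 3 4 5 6}(exponents F) => [|k0 ks] sub_ks path_ks path_F.
  by rewrite big_nil eqxx.
rewrite (@alternating_sum_gaps F z (n - last k0 ks + k0)) //.
have := sub_ks k0 (mem_head _ _); rewrite mem_exponents => Fk0.
by rewrite !mulf_eq0 intr_eq0 (negbTE Fk0) expf_eq0 (negbTE z0) andbF.
Qed.

Lemma prim_neq0 N (z : algC) : N.-primitive_root%R z -> z != 0%R.
Proof.
move=> prim_z; apply/eqP=> z0; have := prim_expr_order prim_z; rewrite z0 expr0n.
rewrite -[_ == 0]negbK -lt0n (prim_order_gt0 prim_z) /= => /eqP.
by rewrite eq_sym oner_eq0.
Qed.

Fixpoint part_starts (x : nat) (s : seq nat) : seq nat :=
  if s is k :: s' then x :: part_starts (x + k) s' else [::].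

Lemma size_part_starts x s : size (part_starts x s) = size s.
Proof. by elim: s x => //= k s IHs x; rewrite IHs. Qed.

Lemma part_starts_bounds x s k : 0 \notin s -> k \in part_starts x s ->
  x <= k < x + sumn s.
Proof.
elim: s x => //= m s IHs x; rewrite !inE negb_or => /andP[m0 s0].
case/predU1P=> [->|/(IHs _ s0)]; lia.
Qed.

Lemma part_starts_sorted x s : 0 \notin s -> sorted ltn (part_starts x s).
Proof.
elim: s x => //= k s IHs x; rewrite inE negb_or => /andP[k0 s0].
rewrite path_min_sorted ?IHs //; apply/allP=> m /(part_starts_bounds s0).
by lia.
Qed.

Lemma gaps_part_starts n s : sumn s = n -> gaps n (part_starts 0 s) = s.
Proof.
move=> sum_s; case: s sum_s => //= k s sum_s; rewrite addn0.
suff aux x m t : rcons (pairmap (fun a b => b - a) x (part_starts (x + m) t))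
    (x + m + sumn t - last x (part_starts (x + m) t)) = m :: t.
  by rewrite -[in n - _]sum_s -[in k + _](add0n k) aux.
elim: t x m => [|l t IHt] x m /=; first by rewrite addn0 addKn.
by rewrite addKn addnA IHt.
Qed.

(** The Reinhardt polynomial with exponents [es]: the sign of a term is the
    parity of the rank of its exponent. *)
Definition alternating_poly n (es : seq nat) : {poly int} :=
  (\poly_(j < n) (if j \in es then (-1) ^+ index j es else 0))%R.

Lemma coef_alternating_poly n es j : all (fun k => k < n) es ->
  ((alternating_poly n es)`_j = if j \in es then (-1) ^+ index j es else 0)%R.
Proof.
move=> /allP lt_es; rewrite coef_poly; case: ltnP => // le_nj.
by case: ifP => // /lt_es; rewrite ltnNge le_nj.
Qed.

Lemma exponents_alternating_poly n es : all (fun k => k < n) es -> sorted ltn es ->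
  exponents (alternating_poly n es) = es.
Proof.
move=> lt_es sort_es; apply: (irr_sorted_eq ltn_trans ltnn) => //.
  exact: sorted_exponents.
move=> j; rewrite mem_exponents coef_alternating_poly //.
by case: ifP => // _; rewrite signr_eq0.
Qed.

(** The composition determines the polynomial up to sign and a power of [z];
    conversely a polynomial is built from the starting points of the parts. *)
Lemma reinhardt_compositionP n s : 0 < n ->
  reinhardt_composition n s <->
  odd_composition n s && vanishing (comp_word n s).
Proof.
move=> n_gt0; have [z prim_z] := C_prim_root_exists (leq_trans n_gt0 (leq_pmull n (isT : 0 < 2))).
split=> [RC|/andP[vs]].
  have comp_s := reinhardt_composition_is_composition RC.
  case: RC comp_s => F /and5P[_ small_F alt_F odd_F dvd_F] <- comp_s.
  have vs : odd_composition n (gaps n (exponents F)).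
    by rewrite /odd_composition comp_s size_gaps -(size_map (nth 0%R F)) -nonzero_coefsE.
  rewrite vs (vanishing_alt_sum n_gt0 vs prim_z) -root_alt_sum_gaps ?(prim_neq0 prim_z) //.
  by rewrite -(Cyclotomic_dvdP _ prim_z).
rewrite (vanishing_alt_sum n_gt0 vs prim_z) => /eqP van_s.
have /andP[/andP[s0 /eqP sum_s] odd_s] := vs.
pose es := part_starts 0 s; pose F := alternating_poly n es.
have lt_es : all (fun k => k < n) es.
  by apply/allP=> k /(part_starts_bounds s0); rewrite sum_s.
have sort_es : sorted ltn es by apply: part_starts_sorted.
have expF : exponents F = es by apply: exponents_alternating_poly.
have uniq_es : uniq es by apply: sorted_uniq sort_es; [apply: ltn_trans | apply: ltnn].
have nzF : nonzero_coefs F = [seq ((-1) ^+ i)%R | i <- iota 0 (size es)] :> seq int.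
  rewrite nonzero_coefsE expF; apply: (@eq_from_nth _ 0%R).
    by rewrite !size_map size_iota.
  move=> i; rewrite size_map => lt_i.
  rewrite !(nth_map 0) ?size_iota // nth_iota // coef_alternating_poly // mem_nth //.
  by rewrite index_uniq.
have small_F : all (mem [:: (-1)%R; 0%R; 1%R]) F.
  apply/allP=> c /(nthP 0%R)[j _ <-]; rewrite coef_alternating_poly //=.
  by case: ifP => //; rewrite -signr_odd; case: odd.
have alt_F : sorted (fun a b : int => (a * b < 0)%R) (nonzero_coefs F).
  rewrite nzF; apply/(sortedP 0%R) => i; rewrite size_map size_iota => lt_i.
  rewrite !(nth_map 0) ?size_iota ?(ltnW lt_i) // !nth_iota ?(ltnW lt_i) //.
  by rewrite !add0n exprS mulN1r mulrN -exprD addnn -signr_odd odd_double.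
have gaps_F : gaps n (exponents F) = s by rewrite expF gaps_part_starts.
exists F => //; apply/and5P; split=> //; first exact: size_poly.
  by rewrite nzF size_map size_iota size_part_starts.
rewrite (Cyclotomic_dvdP _ prim_z) (@root_alt_sum_gaps n) ?(prim_neq0 prim_z) //.
by rewrite gaps_F van_s.
Qed.

(** * Vanishing words and sums of shifts *)

Definition sign_at n (b : n.-tuple bool) (k : nat) : algC := ((-1) ^+ ext b k)%R.

(** The product over [m] in [ms] of the operators [1 + S^m], where [S] is the
    shift, applied to [f]. *)
Fixpoint shift_sums (ms : seq nat) (f : nat -> algC) (k : nat) : algC :=
  if ms is m :: ms' then (shift_sums ms' f k + shift_sums ms' f (k + m)%N)%R else f k.

Section Vanishing.
Variable n : nat.
Hypothesis n_gt0 : 0 < n.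
Implicit Types (b : n.-tuple bool) (f : nat -> algC) (w z : algC) (ms : seq nat).

Definition power_sum w f : algC := (\sum_(k < n) f k * w ^+ k)%R.

Lemma sign_at_addn b k : sign_at b (k + n) = (- sign_at b k)%R.
Proof. by rewrite /sign_at ext_addn // signrN. Qed.

Lemma vanishing_power_sum b z : (2 * n).-primitive_root%R z ->
  vanishing b = (power_sum z (sign_at b) == 0%R).
Proof.
move=> prim_z; rewrite (vanishingE _ n_gt0 prim_z) /word_sum size_tuple.
congr (_ == _); apply: eq_bigr => i _.
by rewrite /sign_at ext_small.
Qed.

(** Antiperiodicity and [w^n = -1] make the sum over [n] consecutive indices
    independent of where it starts. *)
Lemma power_sum_shift w f j : (w ^+ n = -1)%R -> (forall k, f (k + n) = (- f k)%R) ->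
  (w ^+ j * power_sum w (fun k => f (k + j)%N) = power_sum w f)%R.
Proof.
move=> wn fN; elim: j => [|j IHj].
  by rewrite mul1r; apply: eq_bigr => k _ /=; rewrite addn0.
rewrite -IHj exprSr -mulrA; congr (_ * _)%R; rewrite /power_sum mulr_sumr.
have fN' k : f (k + j + n) = (- f (k + j)%N)%R by [].
case: n wn fN' => [|m] wn fN'; first by rewrite !big_ord0.
rewrite big_ord_recr big_ord_recl /= mulrCA -exprS wn mulr1.
have -> : m + j.+1 = 0 + j + m.+1 by lia.
rewrite fN' mulrN1 opprK addrC; congr (_ + _)%R.
by apply: eq_bigr => k _; rewrite mulrCA -exprS addnS.
Qed.

Lemma shift_sums_addn ms f k : (forall k, f (k + n) = (- f k)%R) ->
  shift_sums ms f (k + n) = (- shift_sums ms f k)%R.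
Proof.
move=> fN; elim: ms k => //= m ms IHms k.
by rewrite addnAC !IHms opprD.
Qed.

(** On power sums the shift by [m] is the multiplication by [w^-m]. *)
Lemma power_sum_shift_sums w f ms :
    (w ^+ n = -1)%R -> (forall k, f (k + n) = (- f k)%R) ->
  ((\prod_(m <- ms) w ^+ m) * power_sum w (shift_sums ms f) =
   (\prod_(m <- ms) (w ^+ m + 1)) * power_sum w f)%R.
Proof.
move=> wn fN; elim: ms => [|m ms IHms]; first by rewrite !big_nil.
rewrite !big_cons -[RHS]mulrA -IHms /=.
have -> : (power_sum w (shift_sums (m :: ms) f) = power_sum w (shift_sums ms f) +
    power_sum w (fun k => shift_sums ms f (k + m)%N))%R.
  by rewrite /power_sum -big_split; apply: eq_bigr => k _; rewrite /= mulrDl.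
rewrite -(@power_sum_shift w (shift_sums ms f) m wn) => [|k]; last first.
  exact: shift_sums_addn.
by ring.
Qed.

(** For [0 < m < n] the factor [z^m + 1] is nonzero, as [z] has order [2n]. *)
Lemma shift_sums_vanishing b ms :
    {in ms, forall m, 0 < m < n} -> (forall k, shift_sums ms (sign_at b) k = 0%R) ->
  vanishing b.
Proof.
have [z prim_z] := C_prim_root_exists (leq_trans n_gt0 (leq_pmull n (isT : 0 < 2))).
have zn := prim_expn n_gt0 prim_z.
move=> ms_n sum0; rewrite (vanishing_power_sum _ prim_z).
have := power_sum_shift_sums ms zn (sign_at_addn b).
have -> : power_sum z (shift_sums ms (sign_at b)) = 0%R.
  by apply: big1 => k _; rewrite sum0 mul0r.
move/eqP; rewrite mulr0 eq_sym mulf_eq0 => /orP[|//].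
rewrite prodf_seq_eq0 => /hasP[m /ms_n /andP[m_gt0 lt_mn]] /=.
rewrite addr_eq0 => /eqP zm.
have : (2 * n) %| m * 2.
  by rewrite (prim_order_dvd prim_z) exprM zm sqrrN expr1n.
by move/dvdn_leq; lia.
Qed.

(** The resulting sequence has a zero power sum at every [n]-th root [w] of [-1]:
    either [w] is a primitive [2n]-th root of unity and the word vanishes there, or
    some factor [w^(n/p) + 1] is zero.  A polynomial of degree less than [n] with
    [n] roots is zero. *)
Lemma vanishing_shift_sums b ms :
    (forall p, prime p -> odd p -> p %| n -> n %/ p \in ms) -> vanishing b ->
  forall k, shift_sums ms (sign_at b) k = 0%R.
Proof.
have [z prim_z] := C_prim_root_exists (leq_trans n_gt0 (leq_pmull n (isT : 0 < 2))).
move=> ms_primes van_b; set g := shift_sums ms (sign_at b).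
have gN k : g (k + n) = (- g k)%R by apply: shift_sums_addn; apply: sign_at_addn.
have g_root w : (w ^+ n = -1)%R -> power_sum w g = 0%R.
  move=> wn; have w2n : (w ^+ (2 * n) = 1)%R by rewrite mulnC exprM wn sqrrN expr1n.
  have neq1N1 : (1 != -1 :> algC)%R by rewrite -addr_eq0 (pnatr_eq0 _ 2).
  have w0 : w != 0%R.
    by apply: contra_eq_neq wn => ->; rewrite expr0n gtn_eqF // eq_sym oppr_eq0 oner_eq0.
  have := power_sum_shift_sums ms wn (sign_at_addn b).
  suff -> : ((\prod_(m <- ms) (w ^+ m + 1)) * power_sum w (sign_at b) = 0)%R.
    move/eqP; rewrite mulf_eq0 => /orP[|/eqP//].
    by rewrite prodf_seq_eq0 => /hasP[m _ /=]; rewrite expf_eq0 (negbTE w0) andbF.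
  have [|d prim_w dv_d] := prim_order_exists _ w2n; first by rewrite muln_gt0.
  have [d2n|neq_d] := eqVneq d (2 * n).
    rewrite d2n in prim_w.
    by move: van_b; rewrite (vanishing_power_sum b prim_w) => /eqP ->; rewrite mulr0.
  have [e De] := dvdnP dv_d; have e1 : e != 1.
    by apply: contraNneq neq_d => e1; rewrite De e1 mul1n.
  have p_pr : prime (pdiv e).
    apply: pdiv_prime; move: e1 De; case: (e) => [|[|]] //= _; lia.
  have dv_pe := pdiv_dvd e; set p := pdiv e in p_pr dv_pe.
  have [e' De'] := dvdnP dv_pe.
  have odd_p : odd p.
    case: (even_prime p_pr) => // p2; case/negP: neq1N1.
    have : d %| n by apply/dvdnP; exists e'; move: De; rewrite De' p2; lia.
    by rewrite (prim_order_dvd prim_w) wn eq_sym.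
  have p_n : p %| n.
    have : p %| 2 * n by rewrite De dvdn_mulr.
    by rewrite Gauss_dvdr // coprimen2.
  have /(ms_primes _ p_pr odd_p) ms_p := p_n.
  have [m Dm] := dvdnP p_n.
  have Dm' : n %/ p = m by rewrite Dm mulnK ?prime_gt0.
  rewrite Dm' in ms_p.
  suff wm : (w ^+ m = -1)%R.
    by rewrite (big_rem m ms_p) /= wm addNr !mul0r.
  have : (w ^+ m ^+ 2 == 1)%R.
    rewrite -exprM -(prim_order_dvd prim_w); apply/dvdnP; exists e'.
    have p_gt0 := prime_gt0 p_pr; move: De; rewrite De' Dm; nia.
  rewrite sqrf_eq1 => /orP[/eqP wm|/eqP//]; case/negP: neq1N1.
  by rewrite -wn Dm exprM wm expr1n.
pose P := (\poly_(k < n) g k)%R.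
suff P0 : P = 0%R.
  move=> k; rewrite -/g (divn_eq k n) addnC; elim: (k %/ n) => [|m IHm].
    by have := congr1 (fun Q : {poly algC} => Q`_(k %% n))%R P0; rewrite coef_poly coef0 ltn_pmod // addn0.
  by rewrite mulSn addnCA addnC gN IHm oppr0.
pose rs := [seq (z ^+ (2 * i).+1)%R | i <- iota 0 n].
apply: (@roots_geq_poly_eq0 _ _ rs).
- apply/allP=> x /mapP[i _ ->]; apply/rootP.
  rewrite horner_poly; apply: g_root.
  by rewrite -exprM mulnC exprM (prim_expn n_gt0 prim_z) -signr_odd /= mul2n odd_double.
- rewrite map_inj_in_uniq ?iota_uniq // => i j.
  rewrite !mem_iota !add0n /= => lt_i lt_j /eqP; rewrite (eq_prim_root_expr prim_z).
  by rewrite !modn_small; [move/eqP; lia | lia | lia].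
by rewrite size_map size_iota size_poly.
Qed.

Lemma vanishing_shift j b : vanishing (shift j b) = vanishing b.
Proof.
have [z prim_z] := C_prim_root_exists (leq_trans n_gt0 (leq_pmull n (isT : 0 < 2))).
rewrite !(vanishing_power_sum _ prim_z).
rewrite -(@power_sum_shift z (sign_at b) j (prim_expn n_gt0 prim_z) (sign_at_addn b)).
rewrite mulf_eq0 expf_eq0 (negbTE (prim_neq0 prim_z)) andbF /=; congr (_ == _).
by apply: eq_bigr => k _; rewrite /sign_at ext_shift.
Qed.

(** Reversal replaces [z] with its inverse, another primitive root. *)
Lemma vanishing_flip b : vanishing (flip b) = vanishing b.
Proof.
wlog suff W : b / vanishing b -> vanishing (flip b) => [|van_b].
  by apply/idP/idP => [/W|/W//]; rewrite flip_flip.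
have [z prim_z] := C_prim_root_exists (leq_trans n_gt0 (leq_pmull n (isT : 0 < 2))).
have z0 := prim_neq0 prim_z.
have prim_w : (2 * n).-primitive_root%R (z ^+ (2 * n).-1)%R.
  rewrite prim_root_exp_coprime // coprime_sym -[X in coprime X]prednK ?muln_gt0 //.
  exact: coprimeSn.
have zw k : (z ^+ k * z ^+ (2 * n).-1 ^+ k = 1)%R.
  by rewrite -exprMn -exprS prednK ?muln_gt0 // (prim_expr_order prim_z) expr1n.
move: van_b; rewrite (vanishing_power_sum b prim_w) (vanishing_power_sum (flip b) prim_z).
move=> /eqP sum0; rewrite -[_ == _]orFb -(negbTE (expf_neq0 n.-1 (prim_neq0 prim_w))).
rewrite -mulf_eq0 -sum0 /power_sum mulr_sumr; apply/eqP.
rewrite (reindex_inj rev_ord_inj); apply: eq_bigr => k _ /=.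
rewrite mulrCA; congr (_ * _)%R.
  congr (_ ^+ _)%R; rewrite (@ext_flip_sub _ n_gt0 _ _ k) //.
  by have lt_k := ltn_ord k; congr (_ %% _); lia.
have -> : n.-1 = n - k.+1 + k by have lt_k := ltn_ord k; lia.
rewrite exprD mulrAC [(_ * z ^+ _)%R]mulrC zw mul1r //.
Qed.

End Vanishing.

(** * Periodic compositions and classes of words *)

(** [shift n] is negation, so [m] is an antiperiod when shifting by [m] negates. *)
Definition antiperiod n m (b : n.-tuple bool) : bool := shift m b == shift n b.

Definition periodic_words n : {set n.-tuple bool} :=
  [set b | [exists m : 'I_n, (m %| n) && antiperiod m b]].

Section Periodicity.
Variable n : nat.
Hypothesis n_gt0 : 0 < n.
Implicit Types (b x : n.-tuple bool) (s t : seq nat) (j k m : nat).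

Lemma antiperiodP m b :
  reflect (forall k, ext b (k + m) = ~~ ext b k) (antiperiod m b).
Proof.
apply: (iffP eqP) => [eq_mn k|bN].
  by rewrite -ext_shift // eq_mn ext_shift // ext_addn.
by apply: ext_inj => // k; rewrite !ext_shift // ext_addn // bN.
Qed.

Lemma antiperiod_mul m b k e : antiperiod m b ->
  ext b (k + e * m) = ext b k (+) odd e.
Proof.
move/antiperiodP=> bN; elim: e => [|e IHe]; first by rewrite addn0 addbF.
by rewrite mulSn addnCA addnC bN IHe /= addbN.
Qed.

(** An even number of antiperiods is a period, but [n] is not one. *)
Lemma antiperiod_odd m b e : n = e * m -> antiperiod m b -> odd e.
Proof.
move=> Dn anti_b; have := antiperiod_mul 0 e anti_b; rewrite -Dn ext_addn //.
by case: ext; case: odd.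
Qed.

Lemma periodic_wordsP b :
  reflect (exists2 m, (m %| n) && (m < n) & antiperiod m b) (b \in periodic_words n).
Proof.
rewrite inE; apply: (iffP existsP) => [[m /andP[dv_m am]]|[m /andP[dv_m lt_m] am]].
  by exists m; rewrite ?dv_m ?ltn_ord.
by exists (Ordinal lt_m); rewrite dv_m.
Qed.

Lemma antiperiod_shift m j b : antiperiod m (shift j b) = antiperiod m b.
Proof.
wlog suff W : j b / antiperiod m b -> antiperiod m (shift j b).
  apply/idP/idP => [am|]; last exact: W.
  have := W (j * (2 * n).-1) _ am; rewrite shift_add // addnC -mulnS.
  rewrite prednK ?muln_gt0 // (@shift_eq_mod _ n_gt0 _ 0) ?shift0 //.
  by rewrite modnMl mod0n.
move=> /antiperiodP am; apply/antiperiodP => k.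
by rewrite !ext_shift // addnAC am.
Qed.

Lemma antiperiod_flip m b : antiperiod m b -> antiperiod m (flip b).
Proof.
move=> /antiperiodP am; apply/antiperiodP => k.
rewrite !ext_flip //; apply/esym/negbLR; rewrite -am; apply: ext_eq_mod => //.
rewrite mulnDl -!addnA -mulnSr prednK ?muln_gt0 //.
by rewrite addnA [in RHS]addnC modnMDl.
Qed.

Lemma periodic_words_orb b x : x \in orb b ->
  (x \in periodic_words n) = (b \in periodic_words n).
Proof.
wlog suff W : b x / x \in orb b -> b \in periodic_words n -> x \in periodic_words n.
  by move=> xb; apply/idP/idP; apply: W => //; apply: orb_sym.
move=> /orbP[] // j [e ->] /periodic_wordsP[m mn am]; apply/periodic_wordsP.
exists m; rewrite // /act antiperiod_shift.
by case: e => //; apply: antiperiod_flip.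
Qed.

Lemma vanishing_orb b x : x \in orb b -> vanishing x = vanishing b.
Proof.
move=> /orbP[] // j [e ->]; rewrite /act vanishing_shift //.
by case: e; rewrite ?vanishing_flip.
Qed.

(** One factor [1 + S^m] already kills a word of antiperiod [m]. *)
Lemma vanishing_periodic b : b \in periodic_words n -> vanishing b.
Proof.
case/periodic_wordsP=> m /andP[dv_m lt_m] am.
apply: (@shift_sums_vanishing _ n_gt0 _ [:: m]).
  by move=> k; rewrite inE => /eqP->; rewrite lt_m (dvdn_gt0 n_gt0 dv_m).
by move=> k /=; rewrite /sign_at (antiperiodP _ _ am) signrN addrN.
Qed.

Lemma nth_runs_repeat m t e (b : bool) k : odd_composition m t -> k < e * m ->
  nth false (runs b (flatten (nseq e t))) k = ~~ b (+) ext (comp_word m t) k.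
Proof.
move=> vt; have := vt => /andP[/andP[_ /eqP sum_t] odd_t].
elim: e b k => // e IHe b k lt_k.
have m_gt0 : 0 < m by case: (posnP m) lt_k => // ->; rewrite muln0.
rewrite /= runs_cat nth_cat size_runs sum_t; case: ltnP => [lt_km|le_mk].
  rewrite ext_small // comp_wordE //.
  case: b => //=; rewrite -[false]/(~~ true) runs_negb.
  by rewrite (nth_map false) // size_runs sum_t.
rewrite odd_t addbT IHe; last by lia.
by rewrite -[in RHS](subnK le_mk) ext_addn // addbN addNb.
Qed.

Lemma odd_composition_repeat m t e : odd_composition m t -> odd e ->
  odd_composition (e * m) (flatten (nseq e t)).
Proof.
move=> /andP[/andP[t0 /eqP sum_t] odd_t] odd_e.
rewrite /odd_composition /is_composition sumn_flatten map_nseq sumn_nseq sum_t.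
rewrite mulnC eqxx andbT size_flatten /shape map_nseq sumn_nseq oddM odd_t odd_e.
rewrite !andbT; apply: contraNN t0 => /flattenP[u].
by rewrite mem_nseq => /andP[_ /eqP->].
Qed.

(** An odd number of copies of [t] with an odd number of parts each: every copy
    starts with the opposite sign of the previous one, which is an antiperiod.
    Conversely the first [m] letters are the word of a composition of [m]. *)
Lemma periodic_compositionP s : odd_composition n s ->
  periodic_composition n s <-> comp_word n s \in periodic_words n.
Proof.
move=> vs; split=> [[m [t [dv_m lt_m comp_t odd_t Ds]]]|].
  apply/periodic_wordsP; exists m; first by rewrite dv_m.
  have vt : odd_composition m t by rewrite /odd_composition comp_t.
  have m_gt0 : 0 < m by apply: dvdn_gt0 dv_m.
  have odd_e : odd (n %/ m).
    case/andP: vs => _; rewrite Ds size_flatten /shape map_nseq sumn_nseq oddM.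
    by case/andP.
  suff E k : ext (comp_word n s) k = ext (comp_word m t) k.
    by apply/antiperiodP => k; rewrite !E ext_addn.
  rewrite -(@ext_word_of n n_gt0 (ext (comp_word m t))).
    congr (ext _ k); apply: ext_inj_small => i lt_i.
    rewrite !ext_small ?nth_word_of // Ds (nth_runs_repeat true vt) ?divnK //.
  by move=> i; rewrite -{1}(divnK dv_m) ext_addMn // odd_e addbT.
case/periodic_wordsP=> m /andP[dv_m lt_m] am.
have m_gt0 : 0 < m by apply: dvdn_gt0 dv_m.
have Dn : n = n %/ m * m by rewrite divnK.
have odd_e := antiperiod_odd Dn am; set e := n %/ m in Dn odd_e.
have Eu : ext (word_of m (ext (comp_word n s))) =1 ext (comp_word n s).
  by apply: ext_word_of => // k; apply/antiperiodP.
have cut_u : cut (word_of m (ext (comp_word n s))).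
  have /andP[c0 c1] := cut_comp_word n_gt0 vs; rewrite /cut !Eu c0 /=.
  have := antiperiod_mul m.-1 e.-1 am.
  (* The last letters of the first and of the last block agree: an even number of
     antiperiods separates them. *)
  have -> : m.-1 + e.-1 * m = n.-1.
    by case: (e) odd_e Dn => // e'; rewrite mulSn; lia.
  by rewrite c1; case: (e) odd_e => //= e' /negbTE->; rewrite addbF.
have [t vt Et] := cut_surj m_gt0 cut_u.
have /andP[comp_t odd_t] := vt.
exists m, t; split=> //; rewrite -/e.
have vs' : odd_composition n (flatten (nseq e t)).
  by rewrite Dn; apply: odd_composition_repeat.
apply: (comp_word_inj vs vs'); apply: ext_inj_small => i lt_i.
rewrite [in RHS]ext_small // nth_word_of // (nth_runs_repeat true vt) -?Dn //.
by rewrite Et Eu.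
Qed.

(** Being defined on all words, this turns dihedral classes of compositions into
    orbits of words, and [E0] and [E1] into numbers of orbits. *)
Definition word_class b : {set comp_code n} :=
  [set c | odd_composition n (parts c) && (comp_word n (parts c) \in orb b)].

Lemma mem_word_class_exists b :
  exists2 c : comp_code n, odd_composition n (parts c) & comp_word n (parts c) \in orb b.
Proof.
have [j cj] := exists_cut n_gt0 b; have [s vs Es] := cut_surj n_gt0 cj.
have /andP[comp_s _] := vs; have [c Dc] := parts_surj comp_s.
by exists c; rewrite Dc // Es orb_shift.
Qed.

Lemma word_class_eq b x : (word_class b == word_class x) = (x \in orb b).
Proof.
apply/eqP/idP => [eq_bx|xb].
  have [c vc cb] := mem_word_class_exists b.
  have : c \in word_class b by rewrite inE vc.
  rewrite eq_bx inE vc => cx; apply: orb_trans cb _ => //.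
  exact: orb_sym.
by apply/setP=> c; rewrite !inE (orb_eq n_gt0 xb).
Qed.

Lemma dihedral_class_word (c : comp_code n) : odd_composition n (parts c) ->
  dihedral_class c = word_class (comp_word n (parts c)).
Proof. by move=> vc; apply/setP=> d; rewrite !inE (dihedral_equivP n_gt0 _ vc). Qed.

Lemma reinhardt_polygonsE :
  reinhardt_polygons n = [set word_class b | b in @vanishing n].
Proof.
apply/setP=> P; apply/imsetP/imsetP => [[c]|[b van_b ->]].
  rewrite inE => /asboolP/reinhardt_compositionP-/(_ n_gt0)/andP[vc van_c] ->.
  by exists (comp_word n (parts c)); rewrite ?dihedral_class_word.
have [c vc cb] := mem_word_class_exists b; exists c.
  rewrite inE; apply/asboolP/reinhardt_compositionP => //.
  by rewrite vc (vanishing_orb cb).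
by rewrite dihedral_class_word //; apply/eqP; rewrite word_class_eq.
Qed.

Lemma periodic_word_class b : periodic (word_class b) = (b \in periodic_words n).
Proof.
apply/exists_inP/idP => [[c]|per_b].
  rewrite inE => /andP[vc cb] /asboolP/(periodic_compositionP vc).
  by rewrite (periodic_words_orb cb).
have [c vc cb] := mem_word_class_exists b.
exists c; first by rewrite inE vc.
by apply/asboolP/(periodic_compositionP vc); rewrite (periodic_words_orb cb).
Qed.

Lemma E0E : E0 n = #|[set word_class b | b in periodic_words n]|.
Proof.
congr #|pred_of_set _|; rewrite reinhardt_polygonsE; apply/setP=> P; rewrite inE.
apply/andP/imsetP => [[/imsetP[b van_b ->]]|[b per_b ->]].
  by rewrite periodic_word_class => per_b; exists b.
by rewrite periodic_word_class per_b imset_f //; apply: vanishing_periodic.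
Qed.

Definition sporadic_words : {set n.-tuple bool} :=
  [set b | vanishing b & b \notin periodic_words n].

Lemma E1E : E1 n = #|[set word_class b | b in sporadic_words]|.
Proof.
congr #|pred_of_set _|; rewrite reinhardt_polygonsE; apply/setP=> P; rewrite inE.
apply/andP/imsetP => [[/imsetP[b van_b ->]]|[b]].
  by rewrite /sporadic periodic_word_class => per_b; exists b; rewrite // inE; apply/andP.
rewrite inE => /andP[van_b per_b] ->.
by rewrite /sporadic periodic_word_class per_b imset_f.
Qed.

End Periodicity.

(** * Counting classes of words *)

Lemma card_sum_imset (T U : finType) (f : T -> U) (X : {set T}) (F : T -> nat) :
  \sum_(x in X) F x = \sum_(u in f @: X) \sum_(x in X | f x == u) F x.
Proof. exact: (partition_big_imset f). Qed.

Lemma leq_card_imset_fibers (T U : finType) (f : T -> U) (X : {set T}) K :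
  (forall x, x \in X -> #|[set y in X | f y == f x]| <= K) ->
  #|X| <= K * #|f @: X|.
Proof.
move=> le_K; rewrite -sum1_card (card_sum_imset f) mulnC -sum_nat_const.
apply: leq_sum => _ /imsetP[x xX ->].
by rewrite sum1dep_card; apply: le_K.
Qed.

Lemma leq_card_ffun_on (T I U : finType) (X : {set T}) (A : {set U})
    (h : T -> I -> U) :
  {in X & , forall x y, (forall i, h x i = h y i) -> x = y} ->
  {in X, forall x i, h x i \in A} -> #|X| <= #|A| ^ #|I|.
Proof.
move=> h_inj h_A; rewrite -card_ffun_on.
rewrite -(@card_in_imset _ _ (fun x => [ffun i => h x i]) X); last first.
  move=> x y xX yX /ffunP eq_xy; apply: h_inj => // i.
  by have := eq_xy i; rewrite !ffunE.
apply: subset_leq_card; apply/subsetP => _ /imsetP[x xX ->].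
by apply/ffun_onP => i; rewrite ffunE h_A.
Qed.

Lemma leq_card_bigcup (I T : finType) (F : I -> {set T}) :
  #|\bigcup_i F i| <= \sum_i #|F i|.
Proof.
elim/big_rec2: _ => [|i k A _ le_A]; first by rewrite cards0.
by apply: leq_trans (leq_card_setU _ _) _; rewrite leq_add2l.
Qed.

Section OrbitCounting.
Variable n : nat.
Hypothesis n_gt0 : 0 < n.
Implicit Types (b x y : n.-tuple bool) (j k m : nat) (X : {set n.-tuple bool}).

Definition antiperiodic_words m : {set n.-tuple bool} := [set b | antiperiod m b].

Lemma eq_shift_antiperiod m b i j : antiperiod m b -> i = j %[mod 2 * m] ->
  shift i b = shift j b.
Proof.
move=> am eq_ij; apply: ext_inj => // k; rewrite !ext_shift //.
have redm u : ext b (k + u) = ext b (k + u %% (2 * m)).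
  rewrite {1}(divn_eq u (2 * m)) addnCA addnC mulnA antiperiod_mul //.
  by rewrite oddM andbF addbF.
by rewrite (redm i) (redm j) eq_ij.
Qed.

Lemma antiperiod_orb m b x : antiperiod m b -> x \in orb b -> antiperiod m x.
Proof.
move=> am /orbP[] // j [e ->]; rewrite /act antiperiod_shift //.
by case: e => //; apply: antiperiod_flip.
Qed.

Lemma antiperiod_gt0 m b : antiperiod m b -> 0 < m.
Proof.
by move/antiperiodP=> /(_ n_gt0 0); case: m => // ; case: ext.
Qed.

(** For words of antiperiod [m] the shift by [2 * m] is trivial, so an orbit has
    at most [4 * m] elements. *)
Lemma leq_card_classes m X : {in X, forall b, antiperiod m b} ->
  #|X| <= 4 * m * #|[set word_class b | b in X]|.
Proof.
move=> am; apply: leq_card_imset_fibers => x xX.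
have m_gt0 := antiperiod_gt0 (am _ xX).
have -> : 4 * m = #|{: 'I_(2 * m) * bool}|.
  by rewrite card_prod card_ord card_bool; lia.
apply: leq_trans (leq_imset_card (fun u : 'I_(2 * m) * bool => act u.1 u.2 x) _).
apply: subset_leq_card; apply/subsetP=> y.
rewrite inE word_class_eq // => /andP[yX /(orb_sym n_gt0)/orbP[] // j [e Dy]].
have lt_j : j %% (2 * m) < 2 * m by rewrite ltn_pmod ?muln_gt0.
apply/imsetP; exists (Ordinal lt_j, e) => //=; rewrite Dy /act.
apply: (@eq_shift_antiperiod m); last by rewrite /= modn_mod.
by case: e {Dy}; rewrite ?antiperiod_flip ?am.
Qed.

Definition rotated b x : bool := [exists j : 'I_(2 * n), x == shift j b].

Lemma rotatedP b x : reflect (exists j, x = shift j b) (rotated b x).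
Proof.
apply: (iffP existsP) => [[j /eqP->]|[j ->]]; first by exists j.
have lt_j : j %% (2 * n) < 2 * n by rewrite ltn_pmod ?muln_gt0.
by exists (Ordinal lt_j); apply/eqP/shift_eq_mod => //=; rewrite modn_mod.
Qed.

Lemma rotated_sym b x : rotated b x -> rotated x b.
Proof.
case/rotatedP=> j ->; apply/rotatedP; exists (j * (2 * n).-1).
rewrite shift_add // addnC -mulnS prednK ?muln_gt0 //.
by rewrite (@shift_eq_mod _ n_gt0 _ 0) ?shift0 // modnMl mod0n.
Qed.

Lemma rotated_trans b x y : rotated b x -> rotated x y -> rotated b y.
Proof.
case/rotatedP=> j -> /rotatedP[i ->]; apply/rotatedP.
by exists (i + j); rewrite shift_add.
Qed.

Lemma rotated_flip b x : rotated b x -> rotated (flip b) (flip x).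
Proof.
by case/rotatedP=> j ->; apply/rotatedP; exists (j * (2 * n).-1); rewrite flip_shift.
Qed.

Lemma orb_rotated b x : (x \in orb b) = rotated b x || rotated (flip b) x.
Proof.
apply/orbP/orP => // [[j [[] ->]]|[]/rotatedP[j ->]].
- by right; apply/rotatedP; exists j.
- by left; apply/rotatedP; exists j.
- by exists j, false.
- by exists j, true.
Qed.

(** The words fixed by some reflection. *)
Definition symmetric_words X : {set n.-tuple bool} :=
  [set b in X | rotated (flip b) b].

Lemma symmetric_orb b x : rotated (flip b) b -> x \in orb b -> rotated (flip x) x.
Proof.
move=> sym_b; rewrite orb_rotated => xb.
have {xb} bx : rotated b x.
  by case/orP: xb => // fx; apply: rotated_trans fx; apply: rotated_sym.
apply: rotated_trans (bx); apply: rotated_trans sym_b.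
by apply: rotated_flip; apply: rotated_sym.
Qed.

(** When the [2 * m] shifts are distinct, an orbit either has [4 * m] elements or
    consists of at least [2 * m] symmetric words; weighting symmetric words twice
    makes every orbit count for at least [4 * m]. *)
Lemma geq_card_classes m X :
    {in X, forall b, orb b \subset X} -> {in X, forall b, antiperiod m b} ->
    {in X, forall b i j, i < 2 * m -> j < 2 * m -> shift i b = shift j b -> i = j} ->
  4 * m * #|[set word_class b | b in X]| <= #|X| + #|symmetric_words X|.
Proof.
move=> orb_X am free; rewrite -[#|X|]sum1_card.
have -> : #|symmetric_words X| = \sum_(b in X) rotated (flip b) b.
  rewrite -sum1_card (eq_bigl (fun b => (b \in X) && rotated (flip b) b)).
    by rewrite big_mkcondr; apply: eq_bigr => b _; case: rotated.
  by move=> b; rewrite inE.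
rewrite -big_split (card_sum_imset (@word_class n)) mulnC -sum_nat_const.
apply: leq_sum => _ /imsetP[b bX ->].
have fibre x : (x \in X) && (word_class x == word_class b) = (x \in orb b).
  rewrite word_class_eq //; apply/andP/idP => [[_ /(orb_sym n_gt0)]|xb] //.
  by rewrite orb_sym // (subsetP (orb_X _ bX)).
rewrite (eq_bigl (mem (orb b))) //=.
case sym_b: (rotated (flip b) b).
  rewrite (eq_bigr (fun _ => 2)); last first.
    by move=> x /(symmetric_orb sym_b) ->.
  rewrite sum_nat_const.
  suff : 2 * m <= #|orb b| by lia.
  rewrite -[2 * m]card_ord -(@card_imset _ _ (fun j : 'I_(2 * m) => shift j b)).
    by apply: subset_leq_card; apply/subsetP => _ /imsetP[j _ ->]; apply: orb_shift.
  by move=> i j /(free _ bX) eq_ij; apply: val_inj; apply: eq_ij.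
apply: (@leq_trans (\sum_(x in orb b) 1)); last by apply: leq_sum => x _; apply: leq_addr.
rewrite sum1_card.
have -> : 4 * m = #|{: 'I_(2 * m) * bool}|.
  by rewrite card_prod card_ord card_bool; lia.
rewrite -(@card_imset _ _ (fun u : 'I_(2 * m) * bool => act u.1 u.2 b)).
  apply: subset_leq_card; apply/subsetP => _ /imsetP[[j e] _ ->].
  by apply/orbP => //; exists j, e.
have freeb (i j : 'I_(2 * m)) : shift i b = shift j b -> i = j.
  by move=> /(free _ bX) eq_ij; apply: val_inj; apply: eq_ij.
have asym (i j : nat) : shift i b <> shift j (flip b).
  move=> eq_ij; case/negP: (negbT sym_b); apply: (@rotated_trans _ (shift j (flip b))).
    by apply/rotatedP; exists j.
  by rewrite -eq_ij; apply: rotated_sym; apply/rotatedP; exists i.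
move=> [i d] [j e]; rewrite /act /=; case: d; case: e => //.
- move=> eq_ij; congr (_, _); apply: freeb.
  have := congr1 (@flip n) eq_ij; rewrite !flip_shift ?flip_flip //.
  move=> /(congr1 (fun x => shift (i + j) x)); rewrite !shift_add //.
  have modE (u v : nat) : shift (u + v + u * (2 * n).-1) b = shift v b.
    apply: shift_eq_mod => //; rewrite addnAC -mulnS prednK ?muln_gt0 //.
    by rewrite modnMDl.
  by rewrite modE addnC [i + j]addnC [_ + (j + i)]addnC modE => ->.
- by move/esym/asym.
- by move/asym.
by move/freeb->.
Qed.

Lemma symmetric_words_leq m X B : {in X, forall b, antiperiod m b} ->
    (forall c, #|[set b in X | shift c (flip b) == b]| <= B) ->
  #|symmetric_words X| <= 2 * m * B.
Proof.
move=> am le_B.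
apply: (@leq_trans #|\bigcup_(c < 2 * m) [set b in X | shift c (flip b) == b]|).
  apply: subset_leq_card; apply/subsetP => b; rewrite inE => /andP[bX /rotatedP[c Db]].
  have m_gt0 := antiperiod_gt0 (am _ bX).
  have lt_c : c %% (2 * m) < 2 * m by rewrite ltn_pmod ?muln_gt0.
  apply/bigcupP; exists (Ordinal lt_c) => //; rewrite inE bX /=.
  rewrite (@eq_shift_antiperiod m _ _ c) ?modn_mod -?Db //.
  by rewrite antiperiod_flip ?am.
apply: leq_trans (leq_card_bigcup _) _.
apply: (@leq_trans (\sum_(c < 2 * m) B)); first by apply: leq_sum => c _.
by rewrite sum_nat_const card_ord.
Qed.

End OrbitCounting.

(** * Antiperiods and reflections *)

Section Counting.
Variable n : nat.
Hypothesis n_gt0 : 0 < n.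
Implicit Types (b x y : n.-tuple bool) (j k m c : nat) (X : {set n.-tuple bool}).

Lemma ext_gcd_period b d e : 0 < d ->
    (forall k, ext b (k + d) = ext b k) -> (forall k, ext b (k + e) = ext b k) ->
  forall k, ext b (k + gcdn d e) = ext b k.
Proof.
move=> d_gt0 bd be k; case: (egcdnP e d_gt0) => u v Duv _.
have per f m i : (forall j, ext b (j + f) = ext b j) -> ext b (i + m * f) = ext b i.
  by move=> bf; elim: m => [|m IHm]; rewrite ?addn0 // mulSn addnCA addnC bf IHm.
by rewrite -(per e v _ be) -addnA [gcdn _ _ + _]addnC -Duv per.
Qed.

(** With [d] also [g = gcd(d, 2m)] is a period; as [m] is not a period, [2m / g]
    is odd, and then half of [g] is an antiperiod. *)
Lemma antiperiod_refine m b d : antiperiod m b -> 0 < d < 2 * m ->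
    (forall k, ext b (k + d) = ext b k) ->
  exists2 h, (h %| m) && (h < m) & antiperiod h b.
Proof.
move=> am /andP[d_gt0 lt_d] bd; set g := gcdn d (2 * m).
have g_gt0 : 0 < g by rewrite gcdn_gt0 d_gt0.
have bg : forall k, ext b (k + g) = ext b k.
  apply: ext_gcd_period => // k.
  by rewrite mulnC -[m * 2]mulnC (antiperiod_mul n_gt0 _ _ am) addbF.
have per i k : ext b (k + i * g) = ext b k.
  by elim: i => [|i IHi]; rewrite ?addn0 // mulSn addnCA addnC bg IHi.
have lt_g : g < 2 * m by apply: leq_ltn_trans lt_d; apply/dvdn_leq/dvdn_gcdl.
have [e De] := dvdnP (dvdn_gcdr d (2 * m)); rewrite -/g in De.
have odd_e : odd e.
  apply: contraT => /even_halfK De2; have Dm : m = e./2 * g by nia.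
  by have := antiperiodP n_gt0 _ _ am 0; rewrite Dm per; case: ext.
have De2 := odd_double_half e; rewrite odd_e in De2.
have Dg : g = 2 * g./2 by nia.
exists g./2; first by apply/andP; split; [apply/dvdnP; exists e; nia | lia].
apply/antiperiodP => // k; rewrite -(antiperiodP n_gt0 _ _ am).
have -> : m = e./2 * g + g./2 by nia.
by rewrite addnA addnAC per.
Qed.

(** Two equal shifts would give a period smaller than [2 * m], hence a smaller
    antiperiod. *)
Lemma shift_free m b : antiperiod m b ->
    (forall h, h %| m -> h < m -> ~~ antiperiod h b) ->
  forall i j, i < 2 * m -> j < 2 * m -> shift i b = shift j b -> i = j.
Proof.
move=> am no_h i j; wlog le_ij : i j / i <= j => [W lt_i lt_j eq_ij|].
  by case: (leqP i j) => [|/ltnW] le; [apply: W | apply/esym/W].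
move=> _ lt_j eq_ij; apply/eqP; rewrite eqn_leq le_ij leqNgt; apply/negP => lt_ij.
have [||h /andP[hm lt_h]] := @antiperiod_refine m b (j - i) am; first by lia.
  move=> k; have := congr1 (fun x => ext x (k + (2 * n - 1) * i)) eq_ij.
  rewrite !ext_shift //.
  have -> : k + (2 * n - 1) * i + i = k + i * (2 * n) by nia.
  have -> : k + (2 * n - 1) * i + j = k + (j - i) + i * (2 * n) by nia.
  by rewrite !ext_period.
by apply/negP/no_h.
Qed.

Lemma card_antiperiodic_words m : m %| n -> odd (n %/ m) ->
  #|@antiperiodic_words n m| = 2 ^ m.
Proof.
move=> dv_m odd_e; have m_gt0 := dvdn_gt0 n_gt0 dv_m.
have extN (u : m.-tuple bool) k : ext u (k + n) = ~~ ext u k.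
  by rewrite -{1}(divnK dv_m) ext_addMn // odd_e addbT.
rewrite -[2]card_bool -card_tuple -cardsT.
rewrite -(@card_imset _ _ (fun u : m.-tuple bool => word_of n (ext u))).
  congr #|pred_of_set _|; apply/setP=> b; rewrite inE; apply/idP/imsetP => [ab|[u _ ->]].
    exists (word_of m (ext b)) => //; apply: ext_inj => // k.
    by rewrite !ext_word_of // => i; apply/antiperiodP.
  by apply/antiperiodP => // k; rewrite !ext_word_of // ext_addn.
move=> u v eq_uv; apply: ext_inj => // k.
by rewrite -(ext_word_of n_gt0 (extN u)) eq_uv ext_word_of.
Qed.

Lemma ext_eq_modn x y k l : k = l %[mod n] -> ext x l = ext y l -> ext x k = ext y k.
Proof. by rewrite /ext => -> /addIb->. Qed.

(** The reflection maps [k] to [C - k]; residues modulo [r] at distance at most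
    half of [r] after the centre [C / 2] meet every orbit of it.  The bound is
    rounded up so as to cover all parities of [r] and [C]. *)
Lemma reflection_determined c r : 0 < r -> r %| 2 * n ->
  exists a, forall x y, shift c (flip x) = x -> shift c (flip y) = y ->
    (forall t k, t <= uphalf r -> k = a + t %[mod r] -> ext x k = ext y k) ->
  x = y.
Proof.
move=> r_gt0 dv_r; pose C := n.-1 + c * (2 * n).-1; exists C./2 => x y Dx Dy eq_xy.
have reflE b k m : shift c (flip b) = b -> m + k = C %[mod 2 * n] -> ext b k = ext b m.
  move=> Db mkC; rewrite -{1}Db ext_shift //; apply: ext_flip_sub => //.
  rewrite addnA -modnDml mkC modnDml /C -addnA -mulnSr prednK ?muln_gt0 //.
  by rewrite addnC modnMDl.
apply: ext_inj => // k; pose t := (k + C./2 * r.-1) %% r.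
have lt_t : t < r by rewrite ltn_pmod.
have kt : k = C./2 + t %[mod r].
  by rewrite /t modnDmr addnCA -mulnS prednK // addnC modnMDl.
have [le_t|lt_ht] := leqP t (uphalf r); first exact: eq_xy kt.
pose m := C + k * (2 * n).-1.
have mk : m + k = C %[mod 2 * n].
  by rewrite /m -addnA -mulnSr prednK ?muln_gt0 // addnC modnMDl.
rewrite (reflE x k m) // (reflE y k m) //; apply: (eq_xy (r + odd C - t)).
  rewrite leq_subLR -(odd_double_half r) -addnn; move: lt_ht; rewrite uphalf_half.
  by case: (odd C); case: (odd r); clear; lia.
apply/eqP; rewrite -(eqn_modDr k); apply/eqP.
have -> : m + k = C %[mod r] by rewrite -(modn_dvdm _ dv_r) mk modn_dvdm.
rewrite -modnDmr kt modnDmr.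
have -> : C./2 + (r + odd C - t) + (C./2 + t) = 1 * r + C.
  have le_t : t <= r + odd C by rewrite ltnW // ltn_addr.
  have := odd_double_half C; rewrite -addnn; move: (C./2) (nat_of_bool (odd C)) le_t.
  by clear => a b; lia.
by rewrite modnMDl.
Qed.

End Counting.

(** * Words whose length has two odd prime divisors *)

(** Bezout: the multiples of [q] and of [p] together span the residues modulo
    [p * q]. *)
Lemma coprime_span p q m : 0 < p -> 0 < q -> coprime p q ->
  exists i j, [/\ i < p, j < q & m = i * q + j * p %[mod p * q]].
Proof.
move=> p_gt0 q_gt0 /eqP co_pq; have [u v Duv _] := egcdnP q p_gt0.
rewrite co_pq in Duv; pose i := m * v * p.-1; pose j := m * u.
have Dm : i * q + j * p = m * v * (p * q) + m.
  by rewrite /i /j; case: p p_gt0 Duv {i j co_pq} => // p _ Duv; rewrite /=; nia.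
exists (i %% p), (j %% q); rewrite !ltn_mod p_gt0 q_gt0; split=> //.
rewrite -[RHS](modnMDl (i %/ p + j %/ q)).
have -> : (i %/ p + j %/ q) * (p * q) + (i %% p * q + j %% q * p) = i * q + j * p.
  rewrite [in RHS](divn_eq i p) [in RHS](divn_eq j q).
  move: (i %/ p) (i %% p) (j %/ q) (j %% q) => a b c d; clear; nia.
by rewrite Dm modnMDl.
Qed.

Lemma additive_signs (a b c d : bool) :
  ((-1) ^+ a + (-1) ^+ b + ((-1) ^+ c + (-1) ^+ d) = 0 :> algC)%R -> a + b + c + d = 2.
Proof.
have sgnE (e : bool) : ((-1) ^+ e = 1 - 2 * e%:R :> algC)%R by case: e => /=; ring.
rewrite !sgnE => E; apply/eqP; rewrite -(eqr_nat algC) !natrD.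
have : (2 * ((a%:R + b%:R + c%:R + d%:R) - 2) = 0 :> algC)%R by apply: oppr_inj; rewrite oppr0 -[RHS]E; ring.
by move/eqP; rewrite mulf_eq0 (pnatr_eq0 _ 2) subr_eq0.
Qed.

Definition line_grids p q : {set {ffun 'I_p * 'I_q -> bool}} :=
  [set [ffun u => f u.1] | f : {ffun 'I_p -> bool}] :|:
  [set [ffun u => f u.2] | f : {ffun 'I_q -> bool}].

(** The two constant matrices are counted on both sides. *)
Lemma card_line_grids p q : 0 < p -> 0 < q -> #|line_grids p q| <= 2 ^ p + 2 ^ q - 2.
Proof.
move=> p_gt0 q_gt0; rewrite /line_grids cardsU; apply: leq_sub; last first.
  have -> : 2 = #|[set [ffun=> b] | b : bool] : {set {ffun 'I_p * 'I_q -> bool}}|.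
    rewrite card_imset ?card_bool // => b c /ffunP/(_ (Ordinal p_gt0, Ordinal q_gt0)).
    by rewrite !ffunE.
  apply: subset_leq_card; apply/subsetP=> _ /imsetP[b _ ->]; rewrite inE.
  by apply/andP; split; apply/imsetP; exists [ffun=> b] => //; apply/ffunP=> u; rewrite !ffunE.
by apply: leq_add; apply: leq_trans (leq_imset_card _ _) _;
  rewrite card_ffun card_bool card_ord.
Qed.

(** A 0-1 matrix whose mixed second differences vanish is the sum of a function of
    [i] and a function of [j].  If the first one is not constant, two rows differ by
    1 everywhere, which fixes both as constant; then every row is constant. *)
Lemma additive_grid (G : nat -> nat -> bool) :
  (forall i j, G i j + G i.+1 j.+1 = G i.+1 j + G i j.+1 :> nat) ->
  (forall i j, G i j = G i 0) \/ (forall i j, G i j = G 0 j).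
Proof.
move=> add_G.
have step i j : G i j + G i.+1 0 = G i.+1 j + G i 0 :> nat.
  by elim: j => [|j IHj]; [rewrite addnC | have := add_G i j; lia].
have {step} add0 i j : G i j + G 0 0 = G 0 j + G i 0 :> nat.
  by elim: i => [|i IHi]; [rewrite addnC | have := step i j; lia].
have [[i neq_i]|const] := pselect (exists i, G i 0 != G 0 0); last first.
  right=> i j; have := add0 i j.
  have -> : G i 0 = G 0 0 by apply/eqP; apply: contra_notT const => ?; exists i.
  by case: (G i j); case: (G 0 j); case: (G 0 0).
left=> k j; have := add0 i j; have := add0 k j; move: neq_i.
by case: (G k j); case: (G k 0); case: (G i j); case: (G i 0); case: (G 0 j); case: (G 0 0).
Qed.

Section TwoPrimes.
Variables p q r : nat.
Hypotheses (p_gt1 : 1 < p) (q_gt1 : 1 < q) (r_gt0 : 0 < r).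
Hypotheses (odd_p : odd p) (odd_q : odd q) (co_pq : coprime p q).
Notation n := (p * q * r).
Hypothesis n_gt0 : 0 < n.
Implicit Types (x y : n.-tuple bool).

(** The coset of [c] modulo [r], arranged as a matrix.  The shifts by [n / p] and
    [n / q] are odd fractions of the antiperiod; the parity of [i + j] compensates
    for their signs and makes the rows and columns periodic. *)
Definition grid x c i j := ext x (c + i * (q * r) + j * (p * r)) (+) odd (i + j).

Lemma grid_determines x y c k : k = c %[mod r] ->
    (forall i j, i < p -> j < q -> grid x c i j = grid y c i j) ->
  ext x k = ext y k.
Proof.
move=> kc eq_xy; have [p_gt0 q_gt0] : 0 < p /\ 0 < q by split; apply: ltnW.
have [m Dm] : exists m, k + c * n = c + m * r.
  have le_c : c <= k + c * n by rewrite -[c in c <= _]muln1; apply: leq_trans (leq_addl _ _); rewrite leq_mul2l n_gt0 orbT.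
  have : k + c * n = c %[mod r] by rewrite mulnA addnC modnMDl.
  move/eqP; rewrite eqn_mod_dvd // => /dvdnP[m Dm]; exists m.
  by rewrite -Dm subnKC.
have [i [j [lt_i lt_j Dij]]] := coprime_span m p_gt0 q_gt0 co_pq.
apply: (@ext_eq_modn _ _ _ _ (c + i * (q * r) + j * (p * r))).
  have Em : m * r = (i * q + j * p) * r %[mod n] by rewrite -!muln_modl Dij.
  rewrite -[LHS](modnMDl c) addnC Dm -modnDmr Em modnDmr.
  by congr (_ %% _); rewrite mulnDl -!mulnA addnA.
by have /addIb := eq_xy i j lt_i lt_j.
Qed.

Hypothesis primes_n : forall l, prime l -> odd l -> l %| n -> (l == p) || (l == q).

(** The operators [1 + S^(n/p)] and [1 + S^(n/q)] become differences along rows and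
    columns. *)
Lemma vanishing_grid x c : vanishing x ->
  (forall i j, grid x c i j = grid x c i 0) \/ (forall i j, grid x c i j = grid x c 0 j).
Proof.
move=> van_x; apply: additive_grid => i j.
have np : n %/ p = q * r by rewrite -mulnA mulKn // ltnW.
have nq : n %/ q = p * r by rewrite mulnAC mulnK // ltnW.
have ms_n l : prime l -> odd l -> l %| n -> n %/ l \in [:: q * r; p * r].
  by move=> pr_l odd_l /(primes_n pr_l odd_l)/orP[] /eqP->; rewrite !inE ?np ?nq eqxx ?orbT.
have /= := vanishing_shift_sums n_gt0 ms_n van_x (c + i * (q * r) + j * (p * r)).
rewrite /sign_at => /additive_signs.
rewrite /grid.
have -> : c + i.+1 * (q * r) + j.+1 * (p * r) = c + i * (q * r) + j * (p * r) + q * r + p * r by lia.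
have -> : c + i.+1 * (q * r) + j * (p * r) = c + i * (q * r) + j * (p * r) + q * r by lia.
have -> : c + i * (q * r) + j.+1 * (p * r) = c + i * (q * r) + j * (p * r) + p * r by lia.
move: (c + i * (q * r) + j * (p * r)) => k; rewrite !addnS !addSn /= !negbK.
by case: (odd _); case: (ext _ _); case: (ext _ _); case: (ext _ _); case: (ext _ _).
Qed.

Definition grid_of x c : {ffun 'I_p * 'I_q -> bool} := [ffun u : 'I_p * 'I_q => grid x c u.1 u.2].

Lemma grid_of_line x c : vanishing x -> grid_of x c \in line_grids p q.
Proof.
have [p_gt0 q_gt0] : 0 < p /\ 0 < q by split; apply: ltnW.
case/(vanishing_grid c) => H; rewrite inE; apply/orP; [left | right]; apply/imsetP.
  by exists [ffun i => grid_of x c (i, Ordinal q_gt0)] => //; apply/ffunP=> u; rewrite !ffunE H.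
by exists [ffun j => grid_of x c (Ordinal p_gt0, j)] => //; apply/ffunP=> u; rewrite !ffunE H.
Qed.

Lemma grid_of_determines x y c k : k = c %[mod r] -> grid_of x c = grid_of y c ->
  ext x k = ext y k.
Proof.
move=> kc /ffunP eq_xy; apply: (grid_determines kc) => i j lt_i lt_j.
by have := eq_xy (Ordinal lt_i, Ordinal lt_j); rewrite !ffunE.
Qed.

Lemma card_vanishing : #|[set x : n.-tuple bool | vanishing x]| <= (2 ^ p + 2 ^ q - 2) ^ r.
Proof.
apply: (@leq_trans (#|line_grids p q| ^ #|'I_r|)).
  apply: (@leq_card_ffun_on _ _ _ _ _ (fun x (c : 'I_r) => grid_of x c)).
    move=> x y _ _ eq_xy; apply: ext_inj => // k.
    have lt_k : k %% r < r by rewrite ltn_mod.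
    by apply: grid_of_determines (eq_xy (Ordinal lt_k)); rewrite /= modn_mod.
  by move=> x; rewrite inE => van_x c; apply: grid_of_line.
by rewrite card_ord leq_exp2r // card_line_grids // ltnW.
Qed.

(** A symmetric word is determined by its grids on half of the residues. *)
Lemma card_reflected c :
  #|[set x : n.-tuple bool | vanishing x & shift c (flip x) == x]| <=
    (2 ^ p + 2 ^ q - 2) ^ (uphalf r).+1.
Proof.
have dv_r : r %| 2 * n by rewrite dvdn_mull // dvdn_mull.
have [a det_a] := reflection_determined n_gt0 c r_gt0 dv_r.
apply: (@leq_trans (#|line_grids p q| ^ #|'I_(uphalf r).+1|)).
  apply: (@leq_card_ffun_on _ _ _ _ _ (fun x (t : 'I_(uphalf r).+1) => grid_of x (a + t))).
    move=> x y; rewrite !inE => /andP[_ /eqP Dx] /andP[_ /eqP Dy] eq_xy.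
    apply: det_a => // t k le_t kt; rewrite -ltnS in le_t.
    exact: grid_of_determines (eq_xy (Ordinal le_t)).
  by move=> x; rewrite inE => /andP[van_x _] t; apply: grid_of_line.
by rewrite card_ord leq_exp2r // card_line_grids // ltnW.
Qed.

(** Both antiperiods together fix a grid from one of its entries. *)
Lemma card_antiperiodic_inter :
  #|@antiperiodic_words n (q * r) :&: @antiperiodic_words n (p * r)| <= 2 ^ r.
Proof.
rewrite -[r in 2 ^ r]card_ord -[2]card_bool -cardsT.
apply: (@leq_card_ffun_on _ _ _ _ _ (fun x (c : 'I_r) => ext x c)) => // x y.
rewrite !inE => /andP[xq xp] /andP[yq yp] eq_xy; apply: ext_inj => // k.
have lt_k : k %% r < r by rewrite ltn_mod.
apply: (@grid_determines _ _ (k %% r)) => [|i j _ _]; first by rewrite modn_mod.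
rewrite /grid !(antiperiod_mul n_gt0 _ _ xp) !(antiperiod_mul n_gt0 _ _ xq).
rewrite !(antiperiod_mul n_gt0 _ _ yp) !(antiperiod_mul n_gt0 _ _ yq).
by rewrite (eq_xy (Ordinal lt_k)).
Qed.

(** Inclusion-exclusion on the words of antiperiod [n / p] or [n / q]. *)
Lemma card_sporadic_words :
  #|sporadic_words n| + (2 ^ (p * r) + 2 ^ (q * r)) <=
    (2 ^ p + 2 ^ q - 2) ^ r + 2 ^ r.
Proof.
have [p_gt0 q_gt0] : 0 < p /\ 0 < q by split; apply: ltnW.
pose P := @antiperiodic_words n (q * r) :|: @antiperiodic_words n (p * r).
have cardq : #|@antiperiodic_words n (q * r)| = 2 ^ (q * r).
  apply: card_antiperiodic_words => //; first by rewrite -mulnA dvdn_mull.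
  by rewrite -mulnA mulnK // muln_gt0 q_gt0.
have cardp : #|@antiperiodic_words n (p * r)| = 2 ^ (p * r).
  apply: card_antiperiodic_words => //; first by rewrite mulnAC dvdn_mulr.
  by rewrite mulnAC mulKn // muln_gt0 p_gt0.
have perP : P \subset periodic_words n.
  apply/subsetP=> x; rewrite !inE => xP; apply/existsP; case/orP: xP => ax.
    have lt_m : q * r < n by rewrite -mulnA ltn_Pmull // muln_gt0 q_gt0.
    have dv_m : q * r %| n by rewrite -mulnA dvdn_mull.
    by exists (Ordinal lt_m); rewrite ax dv_m.
  have lt_m : p * r < n by rewrite mulnAC ltn_Pmulr // muln_gt0 p_gt0.
  have dv_m : p * r %| n by rewrite mulnAC dvdn_mulr.
  by exists (Ordinal lt_m); rewrite ax dv_m.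
have disj : #|sporadic_words n :|: P| = #|sporadic_words n| + #|P|.
  rewrite cardsU (_ : _ :&: _ = set0) ?cards0 ?subn0 //.
  apply/setP=> x; rewrite in_set0 in_setI; apply/negP=> /andP[].
  by rewrite inE => /andP[_ /negP nper] /(subsetP perP).
have : #|sporadic_words n :|: P| <= (2 ^ p + 2 ^ q - 2) ^ r.
  apply: leq_trans card_vanishing; apply: subset_leq_card.
  apply/subsetP=> x; rewrite in_setU => /orP[|/(subsetP perP)/(vanishing_periodic n_gt0)].
    by rewrite !inE => /andP[].
  by rewrite inE.
rewrite disj /P cardsU cardq cardp; have := card_antiperiodic_inter; lia.
Qed.

End TwoPrimes.

(** * Lengths below 105 *)

Section PolygonCounts.
Variable n : nat.
Hypothesis n_gt0 : 0 < n.

Lemma antiperiodic_sub_periodic m : m %| n -> m < n ->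
  @antiperiodic_words n m \subset periodic_words n.
Proof.
move=> dv_m lt_m; apply/subsetP=> b; rewrite inE => am.
by apply/periodic_wordsP; exists m; rewrite ?dv_m.
Qed.

Lemma E0_lower m : m %| n -> m < n -> odd (n %/ m) -> 2 ^ m <= 4 * m * E0 n.
Proof.
move=> dv_m lt_m odd_e; rewrite -(card_antiperiodic_words n_gt0 dv_m odd_e).
apply: leq_trans (leq_card_classes n_gt0 (m := m) _) _.
  by move=> b; rewrite inE.
rewrite leq_mul2l E0E // subset_leq_card ?orbT // imsetS //.
exact: antiperiodic_sub_periodic.
Qed.

Lemma sporadic_antiperiod : {in sporadic_words n, forall b, antiperiod n b}.
Proof. by move=> b _; apply: eqxx. Qed.

Lemma E1_lower : #|sporadic_words n| <= 4 * n * E1 n.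
Proof. by rewrite E1E //; apply: leq_card_classes => //; apply: sporadic_antiperiod. Qed.

Lemma E1_upper :
  4 * n * E1 n <= #|sporadic_words n| + #|symmetric_words (sporadic_words n)|.
Proof.
rewrite E1E //; apply: geq_card_classes => //.
- move=> b; rewrite inE => /andP[van_b nper_b]; apply/subsetP=> x xb.
  by rewrite inE (vanishing_orb n_gt0 xb) van_b (periodic_words_orb n_gt0 xb).
- exact: sporadic_antiperiod.
move=> b; rewrite inE => /andP[_ nper_b]; apply: shift_free => //.
  exact: eqxx.
move=> h hn lt_h; apply: contra nper_b => ah.
by apply/periodic_wordsP; exists h; rewrite ?hn.
Qed.

Lemma symmetric_words_sub (X : {set n.-tuple bool}) : #|symmetric_words X| <= #|X|.
Proof. by apply: subset_leq_card; apply/subsetP=> b; rewrite inE => /andP[]. Qed.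

(** A single odd prime [p]: one factor [1 + S^(n/p)] has to kill the word. *)
Lemma E1_few_primes m : m < n -> m %| n ->
  (forall l, prime l -> odd l -> l %| n -> n %/ l = m) -> E1 n = 0.
Proof.
move=> lt_m dv_m primes_n; rewrite E1E //.
suff -> : sporadic_words n = set0 by rewrite imset0 cards0.
apply/setP=> b; rewrite in_set0 inE; apply/negP=> /andP[van_b /negP[]].
apply/periodic_wordsP; exists m; rewrite ?dv_m //; apply/antiperiodP => // k.
have ms_n l : prime l -> odd l -> l %| n -> n %/ l \in [:: m].
  by move=> pr_l odd_l l_n; rewrite inE (primes_n l).
have /= := vanishing_shift_sums n_gt0 ms_n van_b k; rewrite /sign_at.
case: (ext b k); case: (ext b (k + m)) => //=.
  by rewrite !expr1 -opprD => /eqP; rewrite oppr_eq0 (pnatr_eq0 _ 2).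
by rewrite !expr0 => /eqP; rewrite (pnatr_eq0 _ 2).
Qed.

(** The empty product of operators does not kill a word: for powers of 2 there is
    no Reinhardt polygon. *)
Lemma E1_no_odd_prime : (forall l, prime l -> odd l -> ~~ (l %| n)) -> E1 n = 0.
Proof.
move=> primes_n; rewrite E1E //.
suff -> : sporadic_words n = set0 by rewrite imset0 cards0.
apply/setP=> b; rewrite in_set0 inE; apply/negP=> /andP[van_b _].
have ms_n l : prime l -> odd l -> l %| n -> n %/ l \in [::].
  by move=> pr_l odd_l l_n; case/negP: (primes_n l pr_l odd_l).
have /= /eqP := vanishing_shift_sums n_gt0 ms_n van_b 0; rewrite /sign_at.
by rewrite signr_eq0.
Qed.

End PolygonCounts.

Definition odd_primes n := [seq l <- primes n | odd l].

Lemma mem_odd_primes n l : 0 < n ->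
  (l \in odd_primes n) = [&& odd l, prime l & l %| n].
Proof. by move=> n_gt0; rewrite mem_filter mem_primes n_gt0. Qed.

Lemma E1_one_odd_prime n : 0 < n -> size (odd_primes n) <= 1 -> E1 n = 0.
Proof.
move=> n_gt0; have := mem_odd_primes _ n_gt0; case: (odd_primes n) => [|p [|//]] memP _.
  apply: E1_no_odd_prime => // l pr_l odd_l; apply/negP=> l_n.
  by have := memP l; rewrite odd_l pr_l l_n.
have /and3P[odd_p pr_p p_n] : [&& odd p, prime p & p %| n] by rewrite -memP mem_head.
apply: (@E1_few_primes _ n_gt0 (n %/ p)) => [||l pr_l odd_l l_n].
- by rewrite ltn_Pdiv ?prime_gt1.
- by rewrite -[X in _ %| X](divnK p_n) dvdn_mulr.
have := memP l; rewrite odd_l pr_l l_n inE => /eqP->//.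
Qed.

Section TwoOddPrimes.
Variables p q r : nat.
Notation n := (p * q * r).
Hypotheses (r_gt0 : 0 < r) (lt_pq : p < q) (odd_primes_n : odd_primes n = [:: p; q]).

Lemma two_odd_primes : [/\ 0 < n, 1 < p & 1 < q] /\ [/\ odd p, odd q & coprime p q] /\
  (forall l, prime l -> odd l -> l %| n -> (l == p) || (l == q)).
Proof.
have [pq_gt0|] := posnP (p * q); last first.
  move=> pq_gt0; have n_gt0 : 0 < n by rewrite muln_gt0 pq_gt0.
  have memP l := mem_odd_primes l n_gt0; rewrite odd_primes_n in memP.
  have /and3P[odd_p pr_p _] : [&& odd p, prime p & p %| n] by rewrite -memP mem_head.
  have /and3P[odd_q pr_q _] : [&& odd q, prime q & q %| n] by rewrite -memP inE mem_head orbT.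
  split; [by rewrite !prime_gt1 | split=> [|l pr_l odd_l l_n]].
    by split; rewrite // prime_coprime // dvdn_prime2 // ltn_eqF.
  by have := memP l; rewrite odd_l pr_l l_n !inE.
by move: odd_primes_n; rewrite pq_gt0 mul0n.
Qed.

(** The third bound improves on the second one when few words are symmetric. *)
Lemma two_primes_bounds (S := #|sporadic_words n|) (M := 2 ^ p + 2 ^ q - 2) :
  [/\ S + (2 ^ (p * r) + 2 ^ (q * r)) <= M ^ r + 2 ^ r,
      4 * n * E1 n <= S + S,
      4 * n * E1 n <= S + 2 * n * M ^ (uphalf r).+1
    & 2 ^ (q * r) <= 4 * (q * r) * E0 n].
Proof.
have [[n_gt0 p_gt1 q_gt1] [[odd_p odd_q co_pq] primes_n]] := two_odd_primes.
have E1_le := E1_upper n_gt0; split.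
- exact: card_sporadic_words.
- by apply: leq_trans E1_le _; rewrite leq_add2l symmetric_words_sub.
- apply: leq_trans E1_le _; rewrite leq_add2l.
  apply: symmetric_words_leq => // [|c]; first exact: sporadic_antiperiod.
  apply: leq_trans (card_reflected p_gt1 q_gt1 r_gt0 odd_p odd_q co_pq n_gt0 primes_n c).
  by apply: subset_leq_card; apply/subsetP=> x; rewrite !inE => /andP[/andP[-> _] ->].
have qr_gt0 : 0 < q * r by rewrite muln_gt0 r_gt0 ltnW.
have Dn : n = p * (q * r) by rewrite mulnA.
apply: E0_lower => //.
- by rewrite Dn dvdn_mull.
- by rewrite Dn ltn_Pmull.
by rewrite Dn mulnK.
Qed.

End TwoOddPrimes.

(** The triples [(p, q, r)] such that [n = p * q * r] is below 105, has [p < q] as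
    odd prime divisors, and [1 < r]. *)
Definition two_prime_cases : seq (nat * nat * nat) :=
  [:: (3, 5, 2); (3, 7, 2); (3, 5, 3); (3, 5, 4); (3, 7, 3); (3, 11, 2); (5, 7, 2);
      (3, 5, 5); (3, 13, 2); (3, 7, 4); (3, 5, 6); (3, 11, 3); (3, 17, 2)].

Definition small_case n : bool :=
  (size (odd_primes n) <= 1) ||
  (if odd_primes n is [:: p; q] then
     [&& p < q, p * q * (n %/ (p * q)) == n &
       (n %/ (p * q) == 1) || ((p, q, n %/ (p * q)) \in two_prime_cases)]
   else false).

Lemma small_case_below_105 : all small_case (iota 1 104).
Proof. by vm_compute. Qed.

(** With [r = 1] the bound on sporadic words is 0; the other cases are numerical,
    and the count of symmetric words is needed for [n = 90] only. *)
Lemma E1_le_E0_below_105 n : 0 < n < 105 -> E1 n <= E0 n.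
Proof.
move=> n_int; have /andP[n_gt0 _] := n_int.
have : small_case n by apply: (allP small_case_below_105); rewrite mem_iota.
case/orP=> [/(E1_one_odd_prime n_gt0)->//|].
case Dpq : (odd_primes n) => [|p [|q [|]]] //; set r := n %/ (p * q).
case/and3P=> lt_pq /eqP Dn cases_r; rewrite -Dn in Dpq n_gt0 *.
have r_gt0 : 0 < r by move: n_gt0; rewrite muln_gt0 => /andP[].
have [] := two_primes_bounds r_gt0 lt_pq Dpq.
case/orP: cases_r => [/eqP->|].
  rewrite !muln1 !expn1 => S0 E1S _ _.
  have {}S0 : #|sporadic_words (p * q)| = 0.
    by have := expn_gt0 2 p; have := expn_gt0 2 q; lia.
  by move: n_gt0 E1S; rewrite S0; case: (E1 _) => //; nia.
move: #|_| (E0 _) (E1 _) => S e0 e1.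
clear; rewrite !inE.
do 12?[case/orP => [/eqP[-> -> ->]|]]; last move=> /eqP[-> -> ->].
all: rewrite ?[uphalf _]/=; clear; lia.
Qed.

(** * Periodic polygons with 105 sides *)

(** An odd multiple of an antiperiod is an antiperiod. *)
Lemma antiperiod_dvd n m l (b : n.-tuple bool) : 0 < n -> antiperiod m b ->
  m %| l -> odd l -> antiperiod l b.
Proof.
move=> n_gt0 am /dvdnP[e ->]; rewrite oddM => /andP[odd_e _].
by apply/antiperiodP => // k; rewrite (antiperiod_mul n_gt0 _ _ am) odd_e addbT.
Qed.

Lemma card_antiperiodic_reflected n m c : 0 < n -> 0 < m -> m %| n ->
  #|[set x in @antiperiodic_words n m | shift c (flip x) == x]| <= 2 ^ (uphalf m).+1.
Proof.
move=> n_gt0 m_gt0 dv_m.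
have [a det_a] := reflection_determined n_gt0 c m_gt0 (dvdn_mull 2 dv_m).
rewrite -[(uphalf m).+1]card_ord -[2]card_bool -cardsT.
apply: (@leq_card_ffun_on _ _ _ _ _ (fun x (t : 'I_(uphalf m).+1) => ext x (a + t))) => //.
move=> x y; rewrite !inE => /andP[ax /eqP Dx] /andP[ay /eqP Dy] eq_xy.
apply: det_a => // t k le_t kt; rewrite -ltnS in le_t.
have red (z : n.-tuple bool) l : antiperiod m z -> ext z l = ext z (l %% m) (+) odd (l %/ m).
  by move=> az; rewrite {1}(divn_eq l m) addnC (antiperiod_mul n_gt0 _ _ az).
rewrite (red x k) // (red y k) // kt; congr (_ (+) _).
by have := eq_xy (Ordinal le_t); rewrite /= (red x (a + t)) // (red y (a + t)) // => /addIb.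
Qed.

Lemma periodic_105 (b : 105.-tuple bool) : b \in periodic_words 105 ->
  [|| antiperiod 35 b, antiperiod 21 b | antiperiod 15 b].
Proof.
case/periodic_wordsP => // m /andP[dv_m lt_m] am.
have : [|| m %| 35, m %| 21 | m %| 15].
  have chk : all (fun m => (m %| 105) ==> [|| m %| 35, m %| 21 | m %| 15]) (iota 0 105).
    by vm_compute.
  by have /(allP chk)/implyP/(_ dv_m) : m \in iota 0 105 by rewrite mem_iota.
by case/or3P=> dv; apply/or3P; [apply: Or31 | apply: Or32 | apply: Or33];
  apply: antiperiod_dvd am dv _.
Qed.

Lemma card_antiperiodic_105 :
  [/\ #|@antiperiodic_words 105 35| = 2 ^ 35, #|@antiperiodic_words 105 21| = 2 ^ 21
    & #|@antiperiodic_words 105 15| = 2 ^ 15].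
Proof. by split; apply: card_antiperiodic_words. Qed.

Lemma card_periodic_105 : #|periodic_words 105| <= 2 ^ 35 + (2 ^ 21 + 2 ^ 15).
Proof.
have [<- <- <-] := card_antiperiodic_105.
apply: (@leq_trans #|@antiperiodic_words 105 35 :|:
    (@antiperiodic_words 105 21 :|: @antiperiodic_words 105 15)|).
  by apply: subset_leq_card; apply/subsetP=> b /periodic_105; rewrite !inE.
by apply: leq_trans (leq_card_setU _ _) _; rewrite leq_add2l leq_card_setU.
Qed.

(** Words of antiperiod 35 but not 21 or 15 have no smaller antiperiod, so their
    orbits have 140 elements up to symmetric words; the remaining periodic words
    are few enough to be counted one by one. *)
Lemma E0_105_upper :
  4 * 35 * E0 105 <= 2 ^ 35 + 2 * 35 * 2 ^ 19 + 4 * 35 * (2 ^ 21 + 2 ^ 15).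
Proof.
pose B := @antiperiodic_words 105 21 :|: @antiperiodic_words 105 15.
pose X := @antiperiodic_words 105 35 :\: B.
have [card35 card21 card15] := card_antiperiodic_105.
have anti35 : {in X, forall b, antiperiod 35 b} by move=> b; rewrite !inE => /andP[].
have E0_le : E0 105 <= #|[set word_class b | b in X]| + (2 ^ 21 + 2 ^ 15).
  rewrite E0E // -card21 -card15.
  apply: (@leq_trans #|[set word_class b | b in X :|: B]|).
    apply: subset_leq_card; apply: imsetS; apply/subsetP=> b /periodic_105.
    by rewrite !inE; case: (antiperiod 21 b); case: (antiperiod 15 b); rewrite ?orbT.
  rewrite imsetU; apply: leq_trans (leq_card_setU _ _) _; rewrite leq_add2l.
  by apply: leq_trans (leq_imset_card _ _) (leq_card_setU _ _).
suff cX : 4 * 35 * #|[set word_class b | b in X]| <= 2 ^ 35 + 2 * 35 * 2 ^ 19.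
  by move: #|_| (E0 105) E0_le cX => cX e0; clear; lia.
have sym_X : #|symmetric_words X| <= 2 * 35 * 2 ^ 19.
  apply: symmetric_words_leq => // c.
  apply: leq_trans (@card_antiperiodic_reflected 105 35 c _ _ _) => //.
  by apply: subset_leq_card; apply/subsetP=> b; rewrite !inE => /andP[/andP[_ ->] ->].
have card_X : #|X| <= 2 ^ 35 by rewrite -card35 subset_leq_card // subsetDl.
apply: leq_trans (leq_add card_X sym_X); apply: geq_card_classes => //.
- move=> b; rewrite !inE negb_or => /andP[/andP[n21 n15] a35].
  apply/subsetP=> x xb; rewrite !inE (antiperiod_orb _ a35 xb) // andbT negb_or.
  apply/andP; split.
    by apply: contra n21 => ax; apply: antiperiod_orb ax (orb_sym _ xb).
  by apply: contra n15 => ax; apply: antiperiod_orb ax (orb_sym _ xb).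
- move=> b; rewrite !inE negb_or => /andP[/andP[n21 n15] a35].
  apply: shift_free => // h hn lt_h.
  have : (h %| 21) || (h %| 15).
    have chk : all (fun h => (h %| 35) ==> ((h %| 21) || (h %| 15))) (iota 0 35).
      by vm_compute.
    by have /(allP chk)/implyP/(_ hn) : h \in iota 0 35 by rewrite mem_iota.
  case/orP=> dv; [apply: contra n21 | apply: contra n15] => ah;
    exact: antiperiod_dvd ah dv _.
Qed.

(** * Sporadic polygons with 105 sides *)

Definition bit (w : seq bool) k : nat := nth false w (k %% 15).

(** A slice collects the signs at the positions with a given residue modulo 7,
    indexed by their residue modulo 15, where the shifts by [105 / 3] and [105 / 5]
    are the shifts by 5 and 6.  Adding 2 keeps the mixed difference natural. *)
Definition second_diff (w : seq bool) : seq nat :=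
  [seq bit w k + bit w (k + 11) + 2 - (bit w (k + 5) + bit w (k + 6)) | k <- iota 0 15].

Definition slices (u : seq nat) : {set 15.-tuple bool} := [set w | second_diff (tval w) == u].

(** The parity of [k] makes the word antiperiodic, as 105 is odd. *)
Definition glue_at (s : 'I_7 -> 15.-tuple bool) k : bool :=
  odd k (+) nth false (s (inord (k %% 7))) (k %% 15).

Definition glue (s : {ffun 'I_7 -> 15.-tuple bool}) : 105.-tuple bool :=
  word_of 105 (glue_at s).

Lemma ext_glue s : ext (glue s) =1 glue_at s.
Proof.
apply: ext_word_of => // k; rewrite /glue_at oddD addbT addNb.
by rewrite -(modnDmr k 105 7) -(modnDmr k 105 15) !addn0.
Qed.

Lemma glue_inj : injective glue.
Proof.
move=> s t eq_st; apply/ffunP=> l; apply: ext_inj_small => i lt_i; rewrite !ext_small //.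
pose k := chinese 7 15 l i.
have k7 : k %% 7 = l by rewrite /k chinese_modl // modn_small.
have k15 : k %% 15 = i by rewrite /k chinese_modr // modn_small.
have : glue_at s k = glue_at t k by rewrite -!ext_glue eq_st.
by rewrite /glue_at => /addbI; rewrite k7 k15 inord_val.
Qed.

Lemma signed_second_diff (e a b c d : bool) :
  ((-1) ^+ (e (+) a) + (-1) ^+ (~~ e (+) b) + ((-1) ^+ (~~ e (+) c) + (-1) ^+ (e (+) d))
   = (-1) ^+ e * (4 - 2 * (a + d + 2 - (b + c))%N%:R) :> algC)%R.
Proof.
have sgnE (f : bool) : ((-1) ^+ f = 1 - 2 * f%:R :> algC)%R by case: f => /=; ring.
rewrite natrB; last by case: a; case: b; case: c; case: d.
by rewrite !signr_addb signrN !natrD (sgnE a) (sgnE b) (sgnE c) (sgnE d); ring.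
Qed.

Lemma shift_sums_glue s k :
  (shift_sums [:: 21; 35]%N (sign_at (glue s)) k =
   (-1) ^+ odd k * (4 - 2 * (nth 0%N (second_diff (s (inord (k %% 7)))) (k %% 15))%:R))%R.
Proof.
have lt_k : k %% 15 < 15 by rewrite ltn_mod.
rewrite (nth_map 0) ?size_iota // nth_iota // add0n /bit !modnDml.
rewrite (modn_mod k) -signed_second_diff /= /sign_at !ext_glue /glue_at.
have mod7 d : d %% 7 = 0 -> (k + d) %% 7 = k %% 7.
  by move=> d7; rewrite -modnDmr d7 addn0.
have mod15 d d' : d %% 15 = d' -> (k + d) %% 15 = (k + d') %% 15.
  by move=> <-; rewrite modnDmr.
rewrite -addnA (mod7 35) // (mod7 21) // (mod7 (21 + 35)) //.
rewrite (mod15 35 5) // (mod15 21 6) // (mod15 (21 + 35) 11) //.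
by rewrite !oddD /= !addbT addbF.
Qed.

(** The shift by 15 moves to another slice at the same residue modulo 15 and
    changes the sign, so equal second differences cancel. *)
Lemma vanishing_glue (s : {ffun 'I_7 -> 15.-tuple bool}) u :
  (forall l, second_diff (s l) = u) -> vanishing (glue s).
Proof.
move=> diff_s; apply: (@shift_sums_vanishing 105 isT _ [:: 15; 21; 35]).
  by move=> m; rewrite !inE => /or3P[] /eqP->.
move=> k; rewrite -[LHS]/(shift_sums [:: 21; 35]%N (sign_at (glue s)) k +
  shift_sums [:: 21; 35]%N (sign_at (glue s)) (k + 15)%N)%R.
rewrite !shift_sums_glue !diff_s oddD addbT signrN mulNr.
by rewrite -(modnDmr k 15 15) addn0 addrN.
Qed.

(** Words built from slices of one type, for distinct types, are distinct. *)
Lemma card_vanishing_105 (us : seq (seq nat)) : uniq us ->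
  \sum_(u <- us) #|slices u| ^ 7 <= #|[set b : 105.-tuple bool | vanishing b]|.
Proof.
move=> uniq_us.
pose A vs := [set s : {ffun 'I_7 -> 15.-tuple bool} | has (fun u => s \in ffun_on (mem (slices u))) vs].
apply: (@leq_trans #|A us|); last first.
  rewrite -(card_imset _ glue_inj); apply: subset_leq_card; apply/subsetP=> _ /imsetP[s + ->].
  rewrite !inE => /hasP[u _ /ffun_onP s_u]; apply: (@vanishing_glue _ u) => l.
  by have := s_u l; rewrite inE => /eqP.
elim: us uniq_us => [|u us IHus] /=; first by rewrite big_nil.
case/andP=> u_us /IHus {}IHus; rewrite big_cons.
have -> : A (u :: us) = [set s in ffun_on (mem (slices u))] :|: A us.
  by apply/setP=> s; rewrite !inE.
rewrite cardsU (_ : _ :&: _ = set0) ?cards0 ?subn0.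
  by rewrite leq_add // [leqRHS]cardsE card_ffun_on card_ord.
apply/setP=> s; rewrite !inE; apply/negP=> /andP[/ffun_onP s_u /hasP[v v_us /ffun_onP s_v]].
have := s_u ord0; have := s_v ord0; rewrite !inE => /eqP-> /eqP Duv.
by rewrite -Duv v_us in u_us.
Qed.

Lemma card_slices_ge (ws : seq (seq bool)) u : uniq ws ->
  all (fun w => size w == 15) ws -> count (fun w => second_diff w == u) ws <= #|slices u|.
Proof.
move=> uniq_ws size_ws; rewrite -size_filter.
set vs := filter _ ws; have uniq_vs : uniq (pmap (insub : _ -> option (15.-tuple bool)) vs).
  by rewrite pmap_sub_uniq // filter_uniq.
have : size (pmap (insub : _ -> option (15.-tuple bool)) vs) = size vs.
  rewrite size_pmap_sub; apply/eqP; rewrite -all_count all_filter.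
  by apply: sub_all size_ws => w /= ->; rewrite implybT.
move=> <-; rewrite -(card_uniqP uniq_vs); apply: subset_leq_card; apply/subsetP=> w.
by rewrite mem_pmap_sub mem_filter inE => /andP[].
Qed.

(** A column is a number below 8, whose binary digits are its three entries. *)
Definition slice_of_columns (cs : seq nat) : seq bool :=
  mkseq (fun k => odd (nth 0 cs (k %% 5) %/ 2 ^ (k %% 3))) 15.

Definition insert_column (j m : nat) (cs : seq nat) : seq nat :=
  take j cs ++ m :: drop j cs.

(** The columns of a slice other than a distinguished one; 0 and 7 stand for the
    constant columns. *)
Definition four_columns : seq (seq nat) :=
  iter 4 (fun css => [seq c :: cs | c <- [:: 0; 7], cs <- css]) [:: [::]] ++
  [seq nseq 4 m | m <- iota 1 6].

Definition candidates (j : nat) : seq (seq bool) :=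
  [seq slice_of_columns (insert_column j m cs) | cs <- four_columns, m <- iota 0 8].

(** Types are represented by slices that vanish outside the column at place [j];
    the values 0 and 7 of [m] are left out, as they give the zero type. *)
Definition column_types (j : nat) : seq (seq nat) :=
  [seq second_diff (slice_of_columns (insert_column j m (nseq 4 0))) | m <- iota 1 6].

Definition slice_types : seq (seq nat) := flatten [seq column_types j | j <- iota 0 5].

(** The 38 slices of zero type are the 32 with constant columns and the 6 with
    equal nonconstant ones.  For a column type [m], four constant columns leave 16
    slices; the other 4 have four equal nonconstant columns. *)
Lemma candidates_check :
  all (fun j => [&& uniq (candidates j), all (fun w => size w == 15) (candidates j) &
    let ds := [seq second_diff w | w <- candidates j] in
    (count_mem (nseq 15 2) ds == 38) &&
      all (fun u => count_mem u ds == 20) (column_types j)]) (iota 0 5).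
Proof. by vm_compute. Qed.

Lemma slice_types_check : uniq (nseq 15 2 :: slice_types) && (size slice_types == 30).
Proof. by vm_compute. Qed.

Lemma card_slices :
  38 <= #|slices (nseq 15 2)| /\ {in slice_types, forall u, 20 <= #|slices u|}.
Proof.
have checkP j : j < 5 -> [/\ 38 <= #|slices (nseq 15 2)| &
    {in column_types j, forall u, 20 <= #|slices u|}].
  move=> lt_j; have j_in : j \in iota 0 5 by rewrite mem_iota.
  have /and3P[uniq_c size_c /andP[/eqP c38 /allP c20]] := allP candidates_check _ j_in.
  split=> [|u /c20/eqP <-]; rewrite -?c38 count_map; exact: card_slices_ge.
split=> [|u /flattenP[_ /mapP[j + ->]]]; first by case: (checkP 0).
by rewrite mem_iota add0n => /andP[_ /checkP[_ le20]]; apply: le20.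
Qed.

Lemma card_vanishing_105_ge :
  38 ^ 7 + 30 * 20 ^ 7 <= #|[set b : 105.-tuple bool | vanishing b]|.
Proof.
have /andP[uniq_u /eqP size_u] := slice_types_check.
have [le38 le20] := card_slices.
apply: leq_trans (card_vanishing_105 uniq_u); rewrite big_cons.
apply: leq_add; first by rewrite leq_exp2r.
rewrite -size_u.
have -> : size slice_types * 20 ^ 7 = \sum_(u <- slice_types) 20 ^ 7.
  by rewrite big_const_seq iter_addn_0 count_predT mulnC.
by rewrite big_seq [X in _ <= X]big_seq; apply: leq_sum => u /le20; rewrite leq_exp2r.
Qed.

Lemma sporadic_exceed_105 : E0 105 < E1 105.
Proof.
have le_V : #|[set b : 105.-tuple bool | vanishing b]| <=
    #|sporadic_words 105| + #|periodic_words 105|.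
  apply: leq_trans (leq_card_setU _ _); apply: subset_leq_card; apply/subsetP=> b.
  by rewrite !inE => ->; rewrite orNb.
have := E1_lower (isT : 0 < 105).
move: card_vanishing_105_ge le_V card_periodic_105 E0_105_upper.
move: #|_| #|_| #|_| (E0 105) (E1 105) => V S P e0 e1; clear; lia.
Qed.

(** * The smallest length with more sporadic polygons *)

Theorem theorem1p2 :
  [/\ 0 < 105,
      E0 105 < E1 105
    & forall n : nat, 0 < n -> E0 n < E1 n -> 105 <= n].
Proof.
split=> [//||n n_gt0]; first exact: sporadic_exceed_105.
by apply: contraTT; rewrite -ltnNge -leqNgt => lt_n; apply: E1_le_E0_below_105; rewrite n_gt0.
Qed.
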